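(* Let $\mathcal{O}$ be a bigraded operad, horizontally bounded on the right, with a derived $A_\infty$-multiplication $m=\sum_{ij}m_{ij}$, and let $A=S\mathfrak{s}\mathcal{O}$. For $j\ge2$ and $x_v=Sy_v\in A$ $(v=1,\dots,j)$, where $y_v\in\mathfrak{s}\mathcal{O}$ has natural bidegree $(k_v,d_v-k_v)$, put $$M_{ij}(x_1,\dots,x_j)=(-1)^{\sum_{v=1}^j(j-v)(d_v-k_v)}\sum_lSb_j(m_{il};y_1,\dots,y_j).$$ Then the maps $M_{ij}$ ($i\ge0$, $j\ge2$), together with the arity-one maps $M_{i1}:A\to A$, $$M_{i1}(x)=\sum_l\big(Sb_1(m_{il};S^{-1}x)-(-1)^{ik+(1-i)(d-1-k)}Sb_1(S^{-1}x;m_{il})\big)\qquad (x\in A^{d-k}_k),$$ determine a derived $A_\infty$-algebra structure on $A$.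
   Context: $R$ is a commutative ring. Bigraded $R$-modules $A=\{A^j_i\}$ are $(\mathbb{Z},\mathbb{Z})$-graded, $A_i^j$ having bidegree $(i,j)$ = (horizontal, vertical), with Koszul rule $(f\otimes g)(x\otimes z)=(-1)^{\langle g,x\rangle}f(x)\otimes g(z)$, $\langle x,y\rangle=x_1y_1+x_2y_2$. Operads are non-symmetric; a bigraded operad is an operad in bigraded $R$-modules. Horizontally bounded on the right: there is an integer such that all components of larger horizontal degree vanish. $S$ is the vertical shift, $S:A\to SA$ of bidegree $(0,1)$ being the identity. Derived $A_\infty$-algebra: a bigraded module $A$ with maps $m_{ij}:A^{\otimes j}\to A$ of bidegree $(i,2-(i+j))$, $i\ge0,j\ge1$, such that for all $u\ge0,v\ge1$: $\sum_{u=i+p,\,v=j+q-1,\,j=r+1+t}(-1)^{rq+t+pj}m_{ij}(1^{\otimes r}\otimes m_{pq}\otimes1^{\otimes t})=0$. A derived $A_\infty$-multiplication on a bigraded operad $\mathcal{O}$ is given by elements $m_{ij}\in\mathcal{O}(j)$, $i\ge0$, $j\ge1$, of bidegree $(i,2-i-j)$ satisfying $\sum_{u=i+p,\,v=j+q-1,\,j=r+1+t}(-1)^{rq+t+pj}m_{ij}\circ_{r+1}m_{pq}=0$ for all $u\ge0,v\ge1$. Vertical operadic suspension: $\mathfrak{s}\mathcal{O}(n)=\mathcal{O}(n)\otimes\Lambda(n)$, where $\Lambda(n)$ is generated by $e^n$ in bidegree $(0,n-1)$ with $e^n\circ_ie^m=(-1)^{(n-i)(m-1)}e^{n+m-1}$;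 explicitly $x\tilde\circ_{r+1}y=(-1)^{(n-1)q+(n-1)(m-1)+r(m-1)}x\circ_{r+1}y$ for $x\in\mathcal{O}(n)$ and $y\in\mathcal{O}(m)$ of vertical degree $q$. $\mathfrak{s}\mathcal{O}$ also denotes the bigraded module $\prod_n\mathfrak{s}\mathcal{O}(n)$ with natural bidegree ($x\in\mathcal{O}(n)$ of bidegree $(k,d-k)$ has natural bidegree $(k,d+n-k-1)$). Braces on $\mathfrak{s}\mathcal{O}$: $b_n(x;x_1,\dots,x_n)=\sum\tilde\gamma(x;1,\dots,1,x_1,1,\dots,1,x_n,1,\dots,1)$, over all order-preserving insertions (zero if $n$ exceeds the arity of $x$), where $\tilde\gamma$ is the composition of $\mathfrak{s}\mathcal{O}$. *)

(* Defs.v *)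
From HB Require Import structures.
From mathcomp Require Import all_boot all_order all_algebra.
From mathcomp Require Import boolp zify.

Set Implicit Arguments.
Unset Strict Implicit.
Unset Printing Implicit Defensive.

Import Order.TTheory GRing.Theory Num.Theory.
Local Open Scope ring_scope.

(* (horizontal, vertical) *)
Definition bideg := (int * int)%type.

Definition bipair (d e : bideg) : int := d.1 * e.1 + d.2 * e.2.

Definition bimod (R : comPzRingType) := bideg -> lmodType R.

Section Homogeneous.
Variables (R : comPzRingType) (I : eqType) (T : I -> lmodType R).

Definition hel := {i : I & T i}.

Definition el (i : I) (x : T i) : hel := Tagged T x.

(* Component of index i in the direct sum of the T i: it is x itself when
   x has index i (hcomp_el), and 0 otherwise (hcomp_neq).  It serves to add up
   elements whose indices are provably but not definitionally equal. *)
Definition hcomp (i : I) (x : hel) : T i := @untag I (fun i => T i) (T i) 0 i id x.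

Lemma hcomp_el i (x : T i) : hcomp i (el x) = x.
Proof.
rewrite /hcomp /untag; case: eqP => [e | //].
by rewrite (eq_axiomK e).
Qed.

Lemma hcomp_neq i (x : hel) : tag x != i -> hcomp i x = 0.
Proof. by move=> /eqP ne; rewrite /hcomp /untag; case: eqP. Qed.

End Homogeneous.

Arguments el {R I} T {i} x.
Arguments hcomp {R I T} i x.

Definition hbim (R : comPzRingType) (A : bimod R) := hel A.

Definition mdeg (R : comPzRingType) (A : bimod R) (xs : seq (hbim A)) : bideg :=
  \sum_(x <- xs) tag x.

Definition sgn (R : comPzRingType) (z : int) : R := (-1) ^+ `|z|%N.
Arguments sgn {R} z.

Definition dprod (R : comPzRingType) (I : Type) (T : I -> lmodType R) : Type :=
  forall i, T i.

Section DProd.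
Variables (R : comPzRingType) (I : Type) (T : I -> lmodType R).
Local Notation P := (dprod T).

HB.instance Definition _ := gen_eqMixin P.
HB.instance Definition _ := gen_choiceMixin P.

Let zero : P := fun i => 0.
Let opp (f : P) : P := fun i => - f i.
Let add (f g : P) : P := fun i => f i + g i.
Let scale (a : R) (f : P) : P := fun i => a *: f i.

Let addA : associative add.
Proof. by move=> f g h; apply: functional_extensionality_dep => i; exact: addrA. Qed.
Let addC : commutative add.
Proof. by move=> f g; apply: functional_extensionality_dep => i; exact: addrC. Qed.
Let add0 : left_id zero add.
Proof. by move=> f; apply: functional_extensionality_dep => i; exact: add0r. Qed.
Let addN : left_inverse zero opp add.
Proof. by move=> f; apply: functional_extensionality_dep => i; exact: addNr. Qed.

HB.instance Definition _ := GRing.isZmodule.Build P addA addC add0 addN.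

Let scaleA a b (f : P) : scale a (scale b f) = scale (a * b) f.
Proof. by apply: functional_extensionality_dep => i; exact: scalerA. Qed.
Let scale1 : left_id 1 scale.
Proof. by move=> f; apply: functional_extensionality_dep => i; exact: scale1r. Qed.
Let scaleDr : right_distributive scale +%R.
Proof. by move=> a f g; apply: functional_extensionality_dep => i; exact: scalerDr. Qed.
Let scaleDl (f : P) : {morph scale^~ f : a b / a + b}.
Proof. by move=> a b; apply: functional_extensionality_dep => i; exact: scalerDl. Qed.

HB.instance Definition _ :=
  GRing.Zmodule_isLmodule.Build R P scaleA scale1 scaleDr scaleDl.

End DProd.

(* Vertical shift: SA has A^{j-1}_i in bidegree (i, j).  [shift_in] is S and
   [shift_out] is S^{-1}; both are the identity on underlying modules. *)
Definition shift (R : comPzRingType) (A : bimod R) : bimod R :=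
  fun d => A (d - (0, 1)).

Definition shift_in (R : comPzRingType) (A : bimod R) (d : bideg)
    (y : A (d - (0, 1))) : shift A d := y.

Definition shift_out (R : comPzRingType) (A : bimod R) (x : hbim (shift A)) :
    hbim A :=
  el A (i := tag x - (0, 1)) (tagged x).

(* Sum over u = i + p, v = j + q - 1, j = r + 1 + t (i, p, r, t >= 0 and
   j, q >= 1) of (-1)^(rq + t + pj) F i j p q r; the bounds on the indices
   follow from these equations. *)
Definition Ainf_sum (R : comPzRingType) (V : lmodType R) (u v : nat)
    (F : forall i j p q : nat, 'I_j -> V) : V :=
  \sum_(i < u.+1) \sum_(p < u.+1 | u == (i + p)%N)
  \sum_(j < v.+1 | (0 < j)%N) \sum_(q < v.+1 | (0 < q)%N && (v == (j + q - 1)%N))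
  \sum_(r < j) \sum_(t < j | j == (r + 1 + t)%N :> nat)
    (-1) ^+ (r * q + t + p * j) *: F i j p q r.

(* The family of maps m_{ij} : A^{(x) j} -> A,
   for all j >= 1, is encoded as one function m i on nonempty sequences of
   homogeneous elements: m i [:: x_1; ..; x_j] is m_{ij}(x_1, .., x_j).
   The value on the empty sequence is irrelevant. *)

Definition multilinear (R : comPzRingType) (A : bimod R)
    (f : seq (hbim A) -> hbim A) : Prop :=
  forall (xs zs : seq (hbim A)) (d e : bideg) (a : R) (y z : A d),
    hcomp e (f (xs ++ el A (a *: y + z) :: zs)) =
    a *: hcomp e (f (xs ++ el A y :: zs)) + hcomp e (f (xs ++ el A z :: zs)).

Definition derived_Ainf_algebra (R : comPzRingType) (A : bimod R)
    (m : nat -> seq (hbim A) -> hbim A) : Prop :=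
  [/\ forall (i : nat) (xs : seq (hbim A)), (0 < size xs)%N ->
        tag (m i xs) = mdeg xs + (i%:Z, 2 - (i%:Z + (size xs)%:Z)),
      forall i : nat, multilinear (m i)
    & forall (u : nat) (xs : seq (hbim A)), (0 < size xs)%N -> forall e : bideg,
        Ainf_sum u (size xs) (fun i j p q r =>
          (* m_{ij} (1^r (x) m_{pq} (x) 1^t) on xs, with its Koszul sign *)
          sgn (bipair (p%:Z, 2 - (p%:Z + q%:Z)) (mdeg (take r xs))) *:
          hcomp e (m i (take r xs ++ m p (take q (drop r xs)) ::
                        drop (r + q) xs))) = 0].

(* [pcomp r x y] is x o_{r+1} y: slots are numbered from 0. *)
Record preoperad (R : comPzRingType) := Preoperad {
  ocar :> nat -> bimod R;
  oone : ocar 1 0;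
  pcomp : forall (n m : nat) (d e : bideg), 'I_n ->
    ocar n d -> ocar m e -> ocar (n + m).-1 (d + e)
}.

Arguments oone {R} p.
Arguments pcomp {R p n m d e} r x y.

Definition ofam (R : comPzRingType) (P : preoperad R) :
  nat * bideg -> lmodType R := fun nd => P nd.1 nd.2.

Definition hop (R : comPzRingType) (P : preoperad R) := hel (ofam P).

Definition oel (R : comPzRingType) (P : preoperad R) (n : nat) (d : bideg)
  (x : P n d) : hop P := el (ofam P) (i := (n, d)) x.
Arguments oel {R} P {n d} x.

Definition arity (R : comPzRingType) (P : preoperad R) (x : hop P) : nat :=
  (tag x).1.

(* Equalities in [hop P] assert the equality of arities and bidegrees together
   with that of the elements. *)
Record operad_axioms (R : comPzRingType) (P : preoperad R) : Prop := {
  pcomp_linl : forall n m d e (r : 'I_n) (a : R) (x x' : P n d) (y : P m e),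
    pcomp r (a *: x + x') y = a *: pcomp r x y + pcomp r x' y;
  pcomp_linr : forall n m d e (r : 'I_n) (a : R) (x : P n d) (y y' : P m e),
    pcomp r x (a *: y + y') = a *: pcomp r x y + pcomp r x y';
  pcomp_1l : forall m e (y : P m e), oel P (pcomp ord0 (oone P) y) = oel P y;
  pcomp_1r : forall n d (r : 'I_n) (x : P n d),
    oel P (pcomp r x (oone P)) = oel P x;
  pcomp_seq : forall n m k d e f (x : P n d) (y : P m e) (z : P k f)
      (r : 'I_n) (s : 'I_m) (w : 'I_(n + m).-1), w = (r + s)%N :> nat ->
    oel P (pcomp w (pcomp r x y) z) = oel P (pcomp r x (pcomp s y z));
  pcomp_par : forall n m k d e f (x : P n d) (y : P m e) (z : P k f)
      (r s : 'I_n) (w : 'I_(n + m).-1) (w' : 'I_(n + k).-1), (r < s)%N ->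
      w = (s + m).-1 :> nat -> w' = r :> nat ->
    oel P (pcomp w (pcomp r x y) z) =
    oel P (sgn (bipair e f) *: pcomp w' (pcomp s x z) y)
}.

Record operad (R : comPzRingType) := Operad {
  operad_data :> preoperad R;
  operadP : operad_axioms operad_data
}.

Definition hbounded_right (R : comPzRingType) (P : preoperad R) : Prop :=
  exists N : int, forall (n : nat) (d : bideg), N < d.1 ->
    forall x : P n d, x = 0.

(* The components m i 0 are not part of the structure and are never used. *)
Definition derived_Ainf_multiplication (R : comPzRingType) (O : preoperad R)
    (m : forall i j : nat, O j (i%:Z, 2 - i%:Z - j%:Z)) : Prop :=
  forall u v : nat, (0 < v)%N -> forall e : bideg,
    Ainf_sum u v (fun i j p q r =>
      hcomp (v, e) (oel O (pcomp r (m i j) (m p q)))) = 0.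

Section Braces.
Variables (R : comPzRingType) (P : preoperad R).

(* x o_{s+1} y; the default 0 (no slot number s) is never reached in gamma. *)
Definition hpcomp (x : hop P) (s : nat) (y : hop P) : hop P :=
  oel P (if insub s is Some r then pcomp r (tagged x) (tagged y) else 0).

Fixpoint gamma_from (s : nat) (x : hop P) (ys : seq (hop P)) : hop P :=
  if ys is y :: ys' then gamma_from (s + arity y) (hpcomp x s y) ys' else x.

(* gamma(x; y_1, .., y_n)
     = (..((x o_1 y_1) o_{1+a_1} y_2) .. ) o_{1+a_1+..+a_{n-1}} y_n
   with a_v the arity of y_v and n that of x.  Composing from left to right
   keeps x, y_1, .., y_n in order, so no Koszul sign appears. *)
Definition gamma (x : hop P) (ys : seq (hop P)) : hop P := gamma_from 0 x ys.

(* The order-preserving insertion of xs at the positions where b is true,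
   with identities elsewhere; used when count id b = size xs. *)
Fixpoint insertion (b : bitseq) (xs : seq (hop P)) : seq (hop P) :=
  match b, xs with
  | true :: b', x :: xs' => x :: insertion b' xs'
  | _ :: b', _ => oel P (oone P) :: insertion b' xs
  | [::], _ => [::]
  end.

(* The component of arity and bidegree nd of b_n(x; x_1, .., x_n). *)
Definition brace (x : hop P) (xs : seq (hop P)) (nd : nat * bideg) :
    P nd.1 nd.2 :=
  \sum_(b : (arity x).-tuple bool | count id b == size xs)
    hcomp nd (gamma x (insertion b xs)).

Definition prodmod : bimod R := fun d => dprod (fun n => P n d).

Definition piece (n : nat) (x : hbim prodmod) : hop P :=
  oel P (tagged x n : P n (tag x)).

(* The braces on the product over n of the P n.  A brace of pieces of arities
   l, a_1, .., a_j vanishes unless j <= l and has arity l - j + a_1 + .. + a_j,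
   so only l <= N + j and a_v <= N contribute in arity N. *)
Definition pbrace (x : hbim prodmod) (ys : seq (hbim prodmod)) : hbim prodmod :=
  el prodmod (i := tag x + mdeg ys) (fun N =>
    \sum_(l < (N + size ys).+1) \sum_(a : (size ys).-tuple 'I_N.+1)
      brace (piece l x)
            [seq piece ya.2 ya.1 | ya : hbim prodmod * 'I_N.+1 <- zip ys a]
            (N, tag x + mdeg ys)).

End Braces.

(* Vertical operadic suspension, graded by the natural bidegree: x in O(n)
   of bidegree d sits in sO(n) in bidegree d + (0, n - 1). *)

Lemma susp_deg_one : 0 = 0 - (0, 1%:Z - 1) :> bideg.
Proof. by []. Qed.

Lemma susp_deg_comp (n m : nat) (d e : bideg) (r : 'I_n) :
  (d - (0, n%:Z - 1)) + (e - (0, m%:Z - 1)) =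
  (d + e) - (0, (n + m).-1%:Z - 1).
Proof.
case: n r => [[] // | n _]; case: d e => [d1 d2] [e1 e2] /=.
rewrite -[LHS]/(d1 - 0 + (e1 - 0), d2 - (n.+1%:Z - 1) + (e2 - (m%:Z - 1))).
rewrite -[RHS]/(d1 + e1 - 0, d2 + e2 - ((n + m)%N%:Z - 1)) !subr0.
by congr pair; lia.
Qed.

Definition osusp (R : comPzRingType) (P : preoperad R) : preoperad R :=
  {| ocar := fun n d => P n (d - (0, n%:Z - 1));
     oone := ecast d (P 1%N d) susp_deg_one (oone P);
     pcomp := fun n m d e r x y =>
       let q := (e - (0, m%:Z - 1)).2 in
       sgn ((n%:Z - 1) * q + (n%:Z - 1) * (m%:Z - 1) + r%:Z * (m%:Z - 1)) *:
       ecast d (P (n + m).-1 d) (susp_deg_comp m d e r) (pcomp r x y) |}.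

Section BraceMaps.
Variables (R : comPzRingType) (O : preoperad R).
Variable m : forall i j : nat, O j (i%:Z, 2 - i%:Z - j%:Z).

Lemma susp_deg_mult (i l : nat) :
  (i%:Z, 2 - i%:Z - l%:Z) = (i%:Z, 1 - i%:Z) - (0, l%:Z - 1) :> bideg.
Proof.
rewrite -[RHS]/(i%:Z - 0, 1 - i%:Z - (l%:Z - 1)) subr0; congr pair.
by lia.
Qed.

(* The sum over l >= 1 of the m_{il}, in the product of the sO(l); with it
   b_j(mult_row i; ..) is the sum over l of the b_j(m_{il}; ..). *)
Definition mult_row (i : nat) : hbim (prodmod (osusp O)) :=
  el (prodmod (osusp O)) (i := (i%:Z, 1 - i%:Z)) (fun l =>
    if (0 < l)%N then ecast d (O l d) (susp_deg_mult i l) (m i l) else 0).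

Definition brace_maps (i : nat) (xs : seq (hbim (shift (prodmod (osusp O))))) :
    hbim (shift (prodmod (osusp O))) :=
  let ys := [seq shift_out x | x <- xs] in
  let D := mdeg xs + (i%:Z, 2 - (i%:Z + (size xs)%:Z)) in
  let S_ z := shift_in (hcomp (D - (0, 1)) z) in
  el (shift (prodmod (osusp O))) (i := D)
    (if ys is [:: y] then
       let: (k, c) := tag y in
       S_ (pbrace (mult_row i) [:: y])
         - sgn (i%:Z * k + (1 - i%:Z) * c) *: S_ (pbrace y [:: mult_row i])
     else
       sgn (\sum_(v < size ys)
              (size ys - v.+1)%N%:Z * [seq (tag y).2 | y <- ys]`_v) *:
         S_ (pbrace (mult_row i) ys)).

End BraceMaps.

(* Main.v *)
Require Import Defs.
From mathcomp Require Import all_boot all_order all_algebra.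
From mathcomp Require Import boolp zify ring.
Import GRing.Theory.
Local Open Scope ring_scope.
Set Implicit Arguments.
Unset Strict Implicit.
Unset Printing Implicit Defensive.
Import Order.TTheory Num.Theory.

(** The theorem says that the maps M_i, stripped of the shift S, form a twisted
  square-zero family for the braces.

  Write m_i for the sum over l of the m_{il}, of natural bidegree (i, 1 - i),
  and let B_i be the maps y_1, .., y_n |-> b_n(m_i; y_1, .., y_n), corrected for
  n = 1 by the term - (-1)^<m_i, y> b_1(y; m_i).  Passing from B_i to M_i only
  introduces the signs coming from the shifts, and these turn the sign
  (-1)^(rq + t + pj) of the structure equation into (-1)^p, up to a factor that
  depends only on the inputs (brace_maps_sign, shift_out_brace_maps).  In the
  same way, the signs of the operadic suspension turn the hypothesis on m into
  sum_{i + p = u} (-1)^p b_1(m_i; m_p) = 0 (mult_relation).  It remains to show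
  that sum_{i + p = u} (-1)^p B_i B_p = 0 (brace_op_square), where B_i B_p
  inserts B_p in all possible places, with Koszul signs.

  This follows from two cases of the brace relation.  The expansion of
  b_n(b_1(x; z); y_1, .., y_n) (pbrace_pbrace1), for x = m_i and z = m_p, gives
  the terms of the form b(m_i; .., b_q(m_p; ..), ..) with q >= 1, plus the terms
  with q = 0, in which m_p itself is inserted among the y_v; after summation
  with the signs (-1)^p the total is zero.  The expansion of
  b_1(b_n(x; y_1, .., y_n); z) (pbrace1_pbrace), for x = m_p and z = m_i, gives
  those same q = 0 terms with i and p exchanged, and the terms that contain
  b_1(y_v; m_i).  Since (-1)^p (-1)^<m_i, m_p> = - (-1)^i, the correction terms
  of B_i and B_p cancel what is left.  For n = 1 there is one more group of
  terms, b_1(b_1(y; m_p); m_i), which vanishes by the second expansion and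
  mult_relation.

  The two expansions are proved for single operations.  A brace inserts its
  arguments from left to right, keeping track of the first slot that is still
  free, so it is a sum over a tree of iterated partial compositions (isum).
  Both expansions then are inductions on the list of arguments (isum_hpcomp,
  hpcomp_isum): a slot of a composite x o z lies before, inside or after z,
  sequential associativity handles the slots inside z and parallel
  associativity, with its Koszul sign, the others.  Arguments there are finite
  formal sums of operations, so that the identities are exact and free of
  truncation.  An element of the product over all arities is not such a sum,
  but the component of arity N of a brace only depends on boundedly many of
  its pieces (pbraceE, isum_replace), which transfers the expansions to the
  product. *)

(** * Signs and bidegrees *)

Section Signs.
Variable R : comPzRingType.

(** Every sign is determined by a parity; parities of polynomial expressions are
  compared by reducing them to exclusive disjunctions of atoms (see parity). *)
Definition oddz (z : int) := odd (absz z).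

Lemma oddzD x y : oddz (x + y) = oddz x (+) oddz y.
Proof. by rewrite /oddz; lia. Qed.

Lemma oddzN x : oddz (- x) = oddz x.
Proof. by rewrite /oddz abszN. Qed.

Lemma oddzM x y : oddz (x * y) = oddz x && oddz y.
Proof. by rewrite /oddz abszM oddM. Qed.

Lemma sgn_oddz (z : int) : sgn z = (-1) ^+ oddz z :> R.
Proof. by rewrite /sgn /oddz signr_odd. Qed.

Lemma eq_sgn (x y : int) : oddz x = oddz y -> sgn x = sgn y :> R.
Proof. by rewrite !sgn_oddz => ->. Qed.

Lemma sgnD (x y : int) : sgn (x + y) = sgn x * sgn y :> R.
Proof. by rewrite !sgn_oddz oddzD signr_addb. Qed.

Lemma sgn0 : sgn 0 = 1 :> R. Proof. by []. Qed.

Lemma sgn_sqr (x : int) : sgn x * sgn x = 1 :> R.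
Proof. by rewrite -sgnD sgn_oddz oddzD addbb. Qed.

Lemma bipairDl d d' e : bipair (d + d') e = bipair d e + bipair d' e.
Proof. rewrite /bipair /=; ring. Qed.

Lemma bipairDr d e e' : bipair d (e + e') = bipair d e + bipair d e'.
Proof. rewrite /bipair /=; ring. Qed.

Lemma bipairC d e : bipair d e = bipair e d.
Proof. rewrite /bipair; ring. Qed.

Lemma bipair0 d : bipair d 0 = 0.
Proof. by rewrite /bipair !mulr0. Qed.

Lemma sgn_bipairDr d e e' :
  sgn (bipair d (e + e')) = sgn (bipair d e) * sgn (bipair d e') :> R.
Proof. by rewrite bipairDr sgnD. Qed.

End Signs.

Lemma predz_addn n m : (0 < n)%N -> (n + m).-1%:Z = n%:Z + m%:Z - 1.
Proof. lia. Qed.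

Ltac parity := rewrite !(oddzD, oddzN, oddzM) /= -?[oddz 1]/true;
  repeat (match goal with |- context [oddz ?x] => case: (oddz x) end).

(** * Homogeneous elements and linear functionals *)

Section HelFacts.
Variables (R : comPzRingType) (I : eqType) (T : I -> lmodType R).

Lemma el_tagged (h : hel T) : el T (tagged h) = h.
Proof. by case: h. Qed.

Lemma hcomp_tag (h : hel T) : hcomp (tag h) h = tagged h.
Proof. by case: h => i x; exact: hcomp_el. Qed.

Lemma el_hcomp (i : I) (h : hel T) : tag h = i -> el T (hcomp i h) = h.
Proof. by move<-; case: h => j x; rewrite hcomp_el. Qed.

Lemma hcomp_lin (i j : I) a (x y : T j) :
  hcomp i (el T (a *: x + y)) = a *: hcomp i (el T x) + hcomp i (el T y).
Proof.
have [<-|ne] := eqVneq j i; first by rewrite !hcomp_el.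
by rewrite !hcomp_neq //= scaler0 addr0.
Qed.

Lemma el_ext (h h' : hel T) : tag h = tag h' ->
  (forall i, hcomp i h = hcomp i h') -> h = h'.
Proof.
by case: h h' => i x [j y] /= e; subst j => /(_ i); rewrite !hcomp_el => ->.
Qed.

Definition hsc (a : R) (h : hel T) : hel T := el T (a *: tagged h).

Lemma hsc1 h : hsc 1 h = h.
Proof. by rewrite /hsc scale1r el_tagged. Qed.

Lemma hscA a b h : hsc a (hsc b h) = hsc (a * b) h.
Proof. by rewrite /hsc /= scalerA. Qed.

(** Homogeneous elements of different indices cannot be added, so linearity of a
  function on them is required index by index. *)
Definition hlinear (V : lmodType R) (F : hel T -> V) := forall i a (x y : T i),
  F (el T (a *: x + y)) = a *: F (el T x) + F (el T y).

Lemma hlinear_hcomp i : hlinear (@hcomp R I T i).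
Proof. by move=> j a x y; rewrite hcomp_lin. Qed.

Section HLinear.
Variables (V : lmodType R) (F : hel T -> V) (Flin : hlinear F).

Lemma hlinear0 i : F (el T (0 : T i)) = 0.
Proof.
by have := Flin (-1) (0 : T i) 0; rewrite scaler0 addr0 scaleN1r addNr.
Qed.

Lemma hlinearZ a h : F (hsc a h) = a *: F h.
Proof.
by case: h => i x; rewrite /hsc /= -[_ *: _]addr0 Flin hlinear0 addr0.
Qed.

Lemma hlinear_sum i J (r : seq J) (f : J -> T i) :
  F (el T (\sum_(j <- r) f j)) = \sum_(j <- r) F (el T (f j)).
Proof.
elim: r => [|j r IH]; first by rewrite !big_nil hlinear0.
by rewrite !big_cons -[f j in LHS]scale1r Flin scale1r IH.
Qed.

(** The form in which linearity is used for elements whose indices agree only up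
  to a proof. *)
Lemma hlinear_comb i J (r : seq J) (a : J -> R) (h : J -> hel T) :
  (forall j, tag (h j) = i) ->
  \sum_(j <- r) a j *: F (h j) =
  F (el T (\sum_(j <- r) a j *: hcomp i (h j))).
Proof.
move=> hi; rewrite hlinear_sum; apply: eq_bigr => j _.
by rewrite -hlinearZ -[h j in LHS](el_hcomp (hi j)).
Qed.

End HLinear.

End HelFacts.

Lemma dprod_sumE (R : comPzRingType) I (T : I -> lmodType R) J (r : seq J)
    (f : J -> dprod T) i : (\sum_(j <- r) f j) i = \sum_(j <- r) f j i.
Proof. by elim: r => [|j r IH]; rewrite ?big_nil // !big_cons -IH. Qed.

Section MultiDegree.
Variables (R : comPzRingType) (B : bimod R).
Implicit Types ys zs : seq (hbim B).

Lemma mdeg0 : mdeg ([::] : seq (hbim B)) = 0.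
Proof. by rewrite /mdeg big_nil. Qed.

Lemma mdeg1 (y : hbim B) : mdeg [:: y] = tag y.
Proof. by rewrite /mdeg big_seq1. Qed.

Lemma mdeg_cons (y : hbim B) ys : mdeg (y :: ys) = tag y + mdeg ys.
Proof. by rewrite /mdeg big_cons. Qed.

Lemma mdeg_cat ys zs : mdeg (ys ++ zs) = mdeg ys + mdeg zs.
Proof. by rewrite /mdeg big_cat. Qed.

End MultiDegree.

(** * Rearranging finite sums *)

Lemma sum_triangle (V : nmodType) (s n : nat) (f : nat -> nat -> V) :
  \sum_(s <= v < n) \sum_(s <= w < v) f v w =
  \sum_(s <= w < n) \sum_(w.+1 <= v < n) f v w.
Proof.
transitivity (\sum_(s <= v < n) \sum_(s <= w < n | (w < v)%N) f v w).
  apply: eq_big_nat => v /andP[_ hv].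
  by rewrite (big_nat_widen _ _ n) // ltnW.
rewrite (exchange_big_dep xpredT) //= big_nat [RHS]big_nat.
apply: eq_bigr => w /andP[hw _].
rewrite (@big_nat_widenl _ _ _ w.+1 s) //; exact: leqW.
Qed.

(** Reindexing the slots v > w of an operation of arity n by the slots
  v + m - 1 that they become when an operation of arity m is put into slot w. *)
Lemma sum_shift_pred (V : nmodType) (w n m : nat) (f : nat -> V) : (0 < n)%N ->
  \sum_(w.+1 <= v < n) f (v + m).-1 = \sum_(w + m <= u < (n + m).-1) f u.
Proof.
case: n => // n _.
by rewrite big_add1 big_addn /= addnK; apply: eq_bigr => v _.
Qed.

Lemma exchange_big22 (V : nmodType) (I J : Type) (r : seq I)
    (s : seq J) T U (t : I -> seq T) (u : J -> seq U)
    (f : I -> T -> forall j : J, U -> V) :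
  \sum_(i <- r) \sum_(k <- t i) \sum_(j <- s) \sum_(l <- u j) f i k j l =
  \sum_(j <- s) \sum_(l <- u j) \sum_(i <- r) \sum_(k <- t i) f i k j l.
Proof.
transitivity (\sum_(i <- r) \sum_(j <- s) \sum_(k <- t i) \sum_(l <- u j)
    f i k j l).
  by apply: eq_bigr => i _; rewrite exchange_big.
rewrite exchange_big; apply: eq_bigr => j _.
transitivity (\sum_(i <- r) \sum_(l <- u j) \sum_(k <- t i) f i k j l).
  by apply: eq_bigr => i _; rewrite exchange_big.
by rewrite exchange_big.
Qed.

Lemma exchange_big21 (V : nmodType) (I J T : Type) (r : seq I) (s : seq J)
    (t : I -> seq T) (f : I -> T -> J -> V) :
  \sum_(i <- r) \sum_(k <- t i) \sum_(j <- s) f i k j =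
  \sum_(j <- s) \sum_(i <- r) \sum_(k <- t i) f i k j.
Proof.
rewrite [RHS]exchange_big; apply: eq_bigr => i _; exact: exchange_big.
Qed.

Lemma big_split2 (V : nmodType) (I T : Type) (r : seq I) (t : I -> seq T)
    (f g : I -> T -> V) :
  \sum_(i <- r) \sum_(k <- t i) (f i k + g i k) =
  \sum_(i <- r) \sum_(k <- t i) f i k + \sum_(i <- r) \sum_(k <- t i) g i k.
Proof. by rewrite -big_split /=; apply: eq_bigr => i _; rewrite big_split. Qed.

Lemma sum_antidiag (V : nmodType) (v : nat) (f : nat -> nat -> V) :
  \sum_(0 <= q < v) \sum_(0 <= r < v - q) f q r =
  \sum_(0 <= r < v) \sum_(0 <= q < v - r) f q r.
Proof.
have widen (n k : nat) (h : nat -> V) : (k <= n)%N ->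
    \sum_(0 <= r < n - k) h r = \sum_(0 <= r < n | (r + k < n)%N) h r.
  move=> hk; rewrite (big_nat_widen _ _ n) ?leq_subr //.
  by apply: eq_bigl => r; rewrite andTb; lia.
transitivity (\sum_(0 <= q < v) \sum_(0 <= r < v | (r + q < v)%N) f q r).
  by apply: eq_big_nat => q /andP[_ /ltnW hq]; exact: widen.
rewrite (exchange_big_dep xpredT) //=.
apply: eq_big_nat => r /andP[_ /ltnW hr]; rewrite widen //.
by apply: eq_bigl => q; rewrite addnC.
Qed.

Lemma sum_tuple_cons (V : nmodType) (T : finType) k (Q : pred (seq T))
    (G : seq T -> V) :
  \sum_(b : k.+1.-tuple T | Q b) G b =
  \sum_(c : T) \sum_(b : k.-tuple T | Q (c :: b)) G (c :: b).
Proof.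
rewrite pair_big_dep /=.
rewrite (reindex (fun cb : T * k.-tuple T => [tuple of cb.1 :: cb.2])) //=.
exists (fun b : k.+1.-tuple T => (thead b, [tuple of behead b])) => [[c b]|b] _.
  by congr pair; apply: val_inj.
by rewrite [b in RHS]tuple_eta.
Qed.

Lemma sum_tuple0 (V : nmodType) (T : finType) (Q : pred (seq T))
    (G : seq T -> V) :
  \sum_(b : 0.-tuple T | Q b) G b = if Q [::] then G [::] else 0.
Proof.
rewrite big_mkcond (big_pred1 [tuple]) // => b.
by apply/esym/eqP; exact: tuple0.
Qed.

(** * Partial compositions in an operad *)

Section Operad.
Variables (R : comPzRingType) (P : preoperad R) (PP : operad_axioms P).
Local Notation H := (hop P).
Implicit Types (x y z : H).

Definition bdeg x : bideg := (tag x).2.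

Lemma arity_hpcomp x s y : arity (hpcomp x s y) = (arity x + arity y).-1.
Proof. by []. Qed.

Lemma bdeg_hpcomp x s y : bdeg (hpcomp x s y) = bdeg x + bdeg y.
Proof. by []. Qed.

Lemma hpcomp_oel n m d e (x : P n d) (y : P m e) s (hs : (s < n)%N) :
  hpcomp (oel P x) s (oel P y) = oel P (Defs.pcomp (Ordinal hs) x y).
Proof. by rewrite /hpcomp /= insubT. Qed.

Lemma oel_pcomp n m d e (x : P n d) (y : P m e) (r : 'I_n) :
  oel P (Defs.pcomp r x y) = hpcomp (oel P x) r (oel P y).
Proof. by case: r => r hr; rewrite -hpcomp_oel. Qed.

Lemma hpcomp_hscl a x s y : hpcomp (hsc a x) s y = hsc a (hpcomp x s y).
Proof.
case: x y => [[n d] x] [[m e] y].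
rewrite /hpcomp /hsc /=; case: insubP => [r _ _|_] /=; last by rewrite scaler0.
have lin b (u v : P n d) := pcomp_linl PP r b u v (y : P m e).
have lin0 : Defs.pcomp r 0 (y : P m e) = 0 :> P (n + m).-1 (d + e).
  by have := lin (-1) 0 0; rewrite scaler0 addr0 scaleN1r addNr.
by have := lin a x 0; rewrite lin0 !addr0 => ->.
Qed.

Lemma hpcomp_hscr a x s y : hpcomp x s (hsc a y) = hsc a (hpcomp x s y).
Proof.
case: x y => [[n d] x] [[m e] y].
rewrite /hpcomp /hsc /=; case: insubP => [r _ _|_] /=; last by rewrite scaler0.
have lin b (u v : P m e) := pcomp_linr PP r b (x : P n d) u v.
have lin0 : Defs.pcomp r (x : P n d) 0 = 0 :> P (n + m).-1 (d + e).
  by have := lin (-1) 0 0; rewrite scaler0 addr0 scaleN1r addNr.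
by have := lin a y 0; rewrite lin0 !addr0 => ->.
Qed.

Lemma hpcomp_1l y : hpcomp (oel P (oone P)) 0 y = y.
Proof.
case: y => [[m e] y]; rewrite -!/(oel P _).
by rewrite -(oel_pcomp (oone P) y ord0) (pcomp_1l PP).
Qed.

(** The associativity laws, with natural numbers for the slots: the arities of
  composites then no longer appear in the types. *)
Lemma hpcomp_seq x r y s z : (r < arity x)%N -> (s < arity y)%N ->
  hpcomp (hpcomp x r y) (r + s) z = hpcomp x r (hpcomp y s z).
Proof.
case: x y z => [[n d] x] [[m e] y] [[k f] z]; rewrite /arity /= => hr hs.
have hw : (r + s < (n + m).-1)%N by lia.
rewrite -!/(oel P _) (hpcomp_oel x y hr) (hpcomp_oel y z hs).
by rewrite (hpcomp_oel _ z hw) (hpcomp_oel x _ hr); apply: (pcomp_seq PP).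
Qed.

Lemma hpcomp_par x r s y z : (r < s)%N -> (s < arity x)%N ->
  hpcomp (hpcomp x r y) (s + arity y).-1 z =
  hsc (sgn (bipair (bdeg y) (bdeg z))) (hpcomp (hpcomp x s z) r y).
Proof.
case: x y z => [[n d] x] [[m e] y] [[k f] z]; rewrite /arity /bdeg /= => hrs hs.
have hr : (r < n)%N by lia.
have hw : ((s + m).-1 < (n + m).-1)%N by lia.
have hw' : (r < (n + k).-1)%N by lia.
rewrite -!/(oel P _) (hpcomp_oel x y hr) (hpcomp_oel x z hs).
rewrite (hpcomp_oel _ z hw) (hpcomp_oel _ y hw').
by apply: (pcomp_par PP).
Qed.

Lemma hpcomp_1r x s : (s < arity x)%N -> hpcomp x s (oel P (oone P)) = x.
Proof.
case: x => [[n d] x]; rewrite /arity /= => hs.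
by rewrite -!/(oel P _) hpcomp_oel (pcomp_1r PP).
Qed.

Lemma hlinear_hpcompl (V : lmodType R) (F : H -> V) s z :
  hlinear F -> hlinear (fun x => F (hpcomp x s z)).
Proof.
move=> Fl [n d] a x y; rewrite /hpcomp /= -Fl; case: insubP => [r _ _|_] /=.
  by rewrite (pcomp_linl PP).
by rewrite scaler0 addr0.
Qed.

Lemma hlinear_hpcompr (V : lmodType R) (F : H -> V) s x :
  hlinear F -> hlinear (fun z => F (hpcomp x s z)).
Proof.
move=> Fl [n d] a z y; rewrite /hpcomp /= -Fl; case: insubP => [r _ _|_] /=.
  by rewrite (pcomp_linr PP).
by rewrite scaler0 addr0.
Qed.

(** * Sums over order-preserving insertions *)

(** A finite formal sum of operations of bidegree the first component.  The
  bidegree is recorded because Koszul signs are read off it, also when the sum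
  is empty. *)
Definition fsum := (bideg * seq H)%type.
Definition homog (A : fsum) := all (fun y => bdeg y == A.1) A.2.
Definition fdeg (As : seq fsum) : bideg := \sum_(A <- As) A.1.

Lemma fdeg_cons A As : fdeg (A :: As) = A.1 + fdeg As.
Proof. by rewrite /fdeg big_cons. Qed.

Lemma fdeg_nil : fdeg [::] = 0.
Proof. by rewrite /fdeg big_nil. Qed.

(** The operations obtained from x by composing one term of each formal sum, in
  order, into increasing slots that are at least s.  Putting y into slot w uses
  up the slots before w + arity y of the composite. *)
Fixpoint inserts (s : nat) (x : H) (As : seq fsum) : seq H :=
  if As is A :: As' then
    flatten [seq flatten [seq inserts (w + arity y) (hpcomp x w y) As'
                         | w <- index_iota s (arity x)] | y <- A.2]
  else [:: x].

Section Sums.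
Variables (V : lmodType R) (F : H -> V).

(** Braces and all intermediate sums are values of isum for suitable F; keeping F
  general lets one expansion continue another. *)
Definition isum s x As : V := \sum_(e <- inserts s x As) F e.

Lemma isum_nil s x : isum s x [::] = F x.
Proof. by rewrite /isum big_seq1. Qed.

Lemma isum_cons s x A As : isum s x (A :: As) =
  \sum_(y <- A.2) \sum_(s <= w < arity x)
     isum (w + arity y) (hpcomp x w y) As.
Proof.
rewrite /isum /= big_flatten big_map; apply: eq_bigr => y _.
by rewrite big_flatten big_map.
Qed.

End Sums.

Lemma isum_linear (V : lmodType R) (F : H -> V) s As :
  hlinear F -> hlinear (fun x => isum F s x As).
Proof.
move=> Fl; elim: As s => [|A As IH] s i a x y.
  by rewrite !isum_nil Fl.
rewrite !isum_cons scaler_sumr -big_split; apply: eq_bigr => b _ /=.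
rewrite scaler_sumr -big_split; apply: eq_bigr => w _ /=.
exact: (hlinear_hpcompl w b (IH (w + arity b)%N)).
Qed.

Lemma eq_isum (V : lmodType R) (F G : H -> V) s x As : F =1 G ->
  isum F s x As = isum G s x As.
Proof. by move=> FG; apply: eq_bigr => e _. Qed.

Lemma isum_sum (V : lmodType R) J (r : seq J) (F : J -> H -> V) s x As :
  isum (fun e => \sum_(j <- r) F j e) s x As = \sum_(j <- r) isum (F j) s x As.
Proof. exact: exchange_big. Qed.

Lemma isumD (V : lmodType R) (F G : H -> V) s x As :
  isum (fun e => F e + G e) s x As = isum F s x As + isum G s x As.
Proof. exact: big_split. Qed.

(** Slots before s survive, each argument uses up one slot of x, and bidegrees
  add up; these are the only facts about the leaves that are needed. *)
Lemma eq_isum_leaf (V : lmodType R) (F G : H -> V) s x As :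
  all homog As -> (s <= arity x)%N ->
  (forall e, (s <= arity e)%N -> (arity x <= arity e + size As)%N ->
     bdeg e = bdeg x + fdeg As -> F e = G e) ->
  isum F s x As = isum G s x As.
Proof.
elim: As s x => [|A As IH] s x /=.
  by move=> _ hs FG; rewrite !isum_nil FG ?addn0 ?fdeg_nil ?addr0.
move=> /andP[hA hAs] hs FG.
rewrite !isum_cons; apply: eq_big_seq => y /(allP hA) /eqP hy.
apply: eq_big_nat => w /andP[hw hx].
apply: IH => // [|e]; first by rewrite arity_hpcomp; lia.
rewrite arity_hpcomp bdeg_hpcomp hy => h1 h2 h3.
by apply: FG; [lia|lia|rewrite h3 fdeg_cons addrA].
Qed.

Section Identities.
Variables (V : lmodType R) (F : H -> V).

(** With all slots before z closed, an initial segment of the arguments goes into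
  z and the others into slots of x after z: the first argument that skips the
  rest of z closes z for good. *)
Lemma isum_nested x v z j As : (v < arity x)%N -> (j <= arity z)%N ->
  isum F (v + j) (hpcomp x v z) As =
  \sum_(0 <= q < (size As).+1)
    isum (fun z' => isum F (v + arity z') (hpcomp x v z') (drop q As))
      j z (take q As).
Proof.
move=> hv; elim: As z j => [|A As IH] z j hj.
  by rewrite big_nat1 /= !isum_nil.
rewrite /= big_nat_recl // /= isum_nil addrC.
under eq_bigr => q _ do rewrite /= isum_cons.
rewrite exchange_big /=.
have -> : isum F (v + j) (hpcomp x v z) (A :: As) =
    \sum_(y <- A.2) \sum_(j <= w < arity z)
      isum F (v + (w + arity y)) (hpcomp x v (hpcomp z w y)) As
    + isum F (v + arity z) (hpcomp x v z) (A :: As).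
  rewrite !isum_cons -big_split /=; apply: eq_bigr => y _.
  rewrite arity_hpcomp (big_cat_nat (n := v + arity z)) /=; [|lia|lia].
  congr (_ + _); rewrite [(v + j)%N]addnC big_addn addKn.
  apply: eq_big_nat => w /andP[_ hw].
  by rewrite [(w + v)%N]addnC -addnA hpcomp_seq.
congr (_ + _); apply: eq_bigr => y _.
rewrite exchange_big /=; apply: eq_big_nat => w /andP[_ hw].
by rewrite IH // arity_hpcomp; lia.
Qed.

Hypothesis Flin : hlinear F.

(** The expansion of the brace of a composite.  In each term r counts the
  arguments inserted before z and q those inserted into z.  If the first
  argument goes to a slot w < v, then parallel associativity moves it in front
  of z, at the cost of the sign for exchanging it with z. *)
Lemma isum_hpcomp s x z As : all homog As ->
  \sum_(s <= v < arity x) isum F s (hpcomp x v z) As =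
  \sum_(0 <= r < (size As).+1) \sum_(0 <= q < (size As - r).+1)
    sgn (bipair (bdeg z) (fdeg (take r As))) *:
    isum F s x (take r As ++
      (bdeg z + fdeg (take q (drop r As)), inserts 0 z (take q (drop r As)))
      :: drop (r + q) As).
Proof.
elim: As s x => [|A As IH] s x /=; last move=> /andP[hA hAs].
  rewrite !big_nat1 /= fdeg_nil bipair0 sgn0 scale1r addr0 isum_cons big_seq1.
  by move=> _; apply: eq_bigr => v _; rewrite !isum_nil.
(* The terms in which no argument is inserted before z, that is r = 0. *)
have inner : \sum_(s <= v < arity x) isum F v (hpcomp x v z) (A :: As) =
    \sum_(0 <= q < (size As).+2)
      isum F s x ((bdeg z + fdeg (take q (A :: As)),
                   inserts 0 z (take q (A :: As))) :: drop q (A :: As)).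
  under [RHS]eq_bigr => q _ do rewrite isum_cons exchange_big /=.
  rewrite exchange_big /=; apply: eq_big_nat => v /andP[_ hv].
  by have := isum_nested (A :: As) hv (leq0n (arity z)); rewrite addn0.
rewrite big_nat_recl // /= fdeg_nil bipair0 sgn0.
under [X in _ = X + _]eq_bigr do rewrite scale1r /=.
rewrite -inner addrC.
have -> : \sum_(s <= v < arity x) isum F s (hpcomp x v z) (A :: As) =
   \sum_(s <= v < arity x) \sum_(y <- A.2) \sum_(s <= w < v)
      isum F (w + arity y) (hpcomp (hpcomp x v z) w y) As
   + \sum_(s <= v < arity x) isum F v (hpcomp x v z) (A :: As).
  rewrite -big_split; apply: eq_big_nat => v /andP[hsv hv].
  rewrite !isum_cons -big_split /=; apply: eq_bigr => y _.
  by rewrite (big_cat_nat (n := v)) //= arity_hpcomp; lia.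
congr (_ + _).
rewrite exchange_big /=.
under eq_bigr => y _ do rewrite sum_triangle.
transitivity (\sum_(y <- A.2) \sum_(s <= w < arity x)
   sgn (bipair (bdeg z) A.1) *:
   \sum_((w + arity y)%N <= v < arity (hpcomp x w y))
     isum F (w + arity y) (hpcomp (hpcomp x w y) v z) As).
  apply: eq_big_seq => y /(allP hA) /eqP <-.
  apply: eq_big_nat => w /andP[_ hw].
  rewrite arity_hpcomp scaler_sumr.
  rewrite -sum_shift_pred; last by apply: leq_ltn_trans hw.
  apply: eq_big_nat => v /andP[hwv hv].
  rewrite hpcomp_par // -/(arity _) (hlinearZ (isum_linear _ _ Flin)).
  by rewrite scalerA (bipairC (bdeg y)) sgn_sqr scale1r.
transitivity (\sum_(y <- A.2) \sum_(s <= w < arity x)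
  \sum_(0 <= r < (size As).+1) \sum_(0 <= q < (size As - r).+1)
    sgn (bipair (bdeg z) (fdeg (A :: take r As))) *:
    isum F (w + arity y) (hpcomp x w y) (take r As ++
      (bdeg z + fdeg (take q (drop r As)), inserts 0 z (take q (drop r As)))
      :: drop (r + q) As)).
  apply: eq_bigr => y _; apply: eq_bigr => w _.
  rewrite IH // scaler_sumr; apply: eq_bigr => r _.
  rewrite scaler_sumr; apply: eq_bigr => q _.
  by rewrite scalerA -sgnD -bipairDr fdeg_cons.
rewrite (exchange_big22 _ _ (fun y => index_iota s (arity x))
  (fun r => index_iota 0 (size As - r).+1)) /=.
apply: eq_bigr => r _; apply: eq_bigr => q _.
rewrite isum_cons scaler_sumr; apply: eq_bigr => y _.
by rewrite scaler_sumr.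
Qed.

(** Composing z into a slot that all insertions left behind can be done first; z
  then passes all arguments. *)
Lemma hpcomp_isum_before x v s z As : all homog As ->
  (v < s)%N -> (s <= arity x)%N ->
  isum (fun e => F (hpcomp e v z)) s x As =
  sgn (bipair (bdeg z) (fdeg As)) *:
    isum F (s + arity z).-1 (hpcomp x v z) As.
Proof.
elim: As s x => [|A As IH] s x /=.
  by move=> _ _ _; rewrite !isum_nil fdeg_nil bipair0 sgn0 scale1r.
move=> /andP[hA hAs] hv hs; rewrite !isum_cons scaler_sumr.
apply: eq_big_seq => y /(allP hA) /eqP hy.
case: s hv hs => // s hv hs.
rewrite addSn arity_hpcomp /= -sum_shift_pred; last by apply: leq_trans hs.
rewrite scaler_sumr; apply: eq_big_nat => w /andP[hsw hw].
rewrite IH //; [|lia|rewrite arity_hpcomp; lia].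
rewrite hpcomp_par //; last lia.
rewrite (hlinearZ (isum_linear _ _ Flin)) scalerA fdeg_cons hy.
have -> : ((w + arity y + arity z).-1 = (w + arity z).-1 + arity y)%N by lia.
by rewrite bipairDr sgnD mulrAC sgn_sqr mul1r.
Qed.

Definition fsum_pcomp (A : fsum) z : fsum :=
  (A.1 + bdeg z,
   flatten [seq [seq hpcomp y j z | j <- index_iota 0 (arity y)] | y <- A.2]).

(** The expansion of a composite with a brace.  The slot for z lies before the
  first argument y, inside y, or after y.  The first two cases are settled by
  hpcomp_isum_before, the third by induction. *)
Lemma hpcomp_isum s x z As : all homog As -> (s <= arity x)%N ->
  isum (fun e => \sum_(s <= v < arity e) F (hpcomp e v z)) s x As =
  \sum_(0 <= r < (size As).+1) sgn (bipair (bdeg z) (fdeg (drop r As))) *: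
     isum F s x (take r As ++ (bdeg z, [:: z]) :: drop r As) +
  \sum_(0 <= r < size As) sgn (bipair (bdeg z) (fdeg (drop r.+1 As))) *:
     isum F s x (take r As ++ fsum_pcomp (nth (0, [::]) As r) z
                   :: drop r.+1 As).
Proof.
elim: As s x => [|A As IH] s x /=.
  move=> _ _; rewrite big_nat1 big_geq // addr0 fdeg_nil bipair0 sgn0 scale1r.
  rewrite isum_nil isum_cons big_seq1.
  by apply: eq_bigr => v _; rewrite isum_nil.
move=> /andP[hA hAs] hs.
rewrite big_nat_recl //= [in X in _ + X]big_nat_recl //= drop0 addrACA.
have -> : isum (fun e => \sum_(s <= v < arity e) F (hpcomp e v z)) s x (A :: As)
  = \sum_(y <- A.2) \sum_(s <= w < arity x) \sum_(s <= v < w)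
      isum (fun e => F (hpcomp e v z)) (w + arity y) (hpcomp x w y) As
  + \sum_(y <- A.2) \sum_(s <= w < arity x) \sum_(w <= v < w + arity y)
      isum (fun e => F (hpcomp e v z)) (w + arity y) (hpcomp x w y) As
  + \sum_(y <- A.2) \sum_(s <= w < arity x)
      isum (fun e => \sum_((w + arity y)%N <= v < arity e) F (hpcomp e v z))
        (w + arity y) (hpcomp x w y) As.
  rewrite isum_cons -!big_split /=; apply: eq_bigr => y _.
  rewrite -!big_split /=; apply: eq_big_nat => w /andP[hsw hw].
  rewrite -!isum_sum -!isumD; apply: eq_isum_leaf => //.
    by rewrite arity_hpcomp; lia.
  move=> e he _ _; rewrite (big_cat_nat (n := w)) //=; last lia.
  by rewrite (big_cat_nat (m := w) (n := (w + arity y)%N)) ?leq_addr //= addrA.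
congr (_ + _ + _).
- rewrite isum_cons big_seq1 fdeg_cons.
  under eq_bigr do rewrite sum_triangle.
  rewrite exchange_big scaler_sumr; apply: eq_big_nat => v /andP[hsv hv].
  rewrite isum_cons scaler_sumr; apply: eq_big_seq => y /(allP hA) /eqP hy.
  rewrite arity_hpcomp -sum_shift_pred; last by apply: leq_ltn_trans hv.
  rewrite scaler_sumr; apply: eq_big_nat => w /andP[hvw hw].
  rewrite hpcomp_isum_before //; [|lia|rewrite arity_hpcomp; lia].
  rewrite hpcomp_par //.
  rewrite (hlinearZ (isum_linear _ _ Flin)) scalerA hy.
  have -> : ((w + arity y + arity z).-1 = (w + arity z).-1 + arity y)%N by lia.
  by rewrite bipairDr sgnD mulrAC sgn_sqr mul1r.
- rewrite isum_cons /= big_flatten big_map scaler_sumr.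
  apply: eq_bigr => y _; rewrite big_map exchange_big /= scaler_sumr.
  apply: eq_big_nat => w /andP[hsw hw].
  rewrite -{1}[w]add0n big_addn addKn scaler_sumr.
  apply: eq_big_nat => j /andP[_ hj].
  rewrite hpcomp_isum_before //; [|lia|rewrite arity_hpcomp; lia].
  rewrite [(j + w)%N]addnC hpcomp_seq // arity_hpcomp.
  by do 2 f_equal; lia.
- transitivity (\sum_(y <- A.2) \sum_(s <= w < arity x)
     (\sum_(0 <= r < (size As).+1) sgn (bipair (bdeg z) (fdeg (drop r As))) *:
        isum F (w + arity y) (hpcomp x w y)
          (take r As ++ (bdeg z, [:: z]) :: drop r As) +
      \sum_(0 <= r < size As) sgn (bipair (bdeg z) (fdeg (drop r.+1 As))) *:
        isum F (w + arity y) (hpcomp x w y)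
          (take r As ++ fsum_pcomp (nth (0, [::]) As r) z :: drop r.+1 As))).
    apply: eq_bigr => y _; apply: eq_big_nat => w /andP[_ hw].
    by rewrite IH // arity_hpcomp; lia.
  rewrite big_split2.
  rewrite (exchange_big21 _ _ (fun=> index_iota s (arity x))).
  rewrite [X in _ + X](exchange_big21 _ _ (fun=> index_iota s (arity x))).
  congr (_ + _); apply: eq_bigr => r _.
    rewrite isum_cons scaler_sumr; apply: eq_bigr => y _.
    by rewrite scaler_sumr.
  rewrite isum_cons scaler_sumr; apply: eq_bigr => y _.
  by rewrite scaler_sumr.
Qed.

End Identities.

End Operad.

(** * Braces on the product over all arities *)

Section Braces.
Variables (R : comPzRingType) (P : preoperad R) (PP : operad_axioms P).
Local Notation H := (hop P).
Implicit Types (x y z : H).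

Definition fsum1 x : fsum P := (bdeg x, [:: x]).

(** Identities in an insertion act trivially, so reading the bits from left to
  right amounts to choosing the next slot to fill. *)
Lemma sum_gamma_insertion (V : lmodType R) (F : H -> V) k s x xs :
  arity x = (s + k)%N ->
  \sum_(b : k.-tuple bool | count id b == size xs)
     F (gamma_from s x (insertion b xs)) =
  isum F s x [seq fsum1 y | y <- xs].
Proof.
elim: k s x xs => [|k IH] s x xs hx.
  rewrite (sum_tuple0 (fun b => count id b == size xs)
    (fun b => F (gamma_from s x (insertion b xs)))) /=.
  case: xs => [|y xs] /=; first by rewrite isum_nil.
  by rewrite isum_cons big_seq1 big_geq // hx addn0.
rewrite (sum_tuple_cons k (fun b => count id b == size xs)
  (fun b => F (gamma_from s x (insertion b xs)))).
have hs : (s < arity x)%N by lia.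
rewrite big_bool /= (hpcomp_1r PP) //.
under [X in _ + X]eq_bigl do rewrite add0n.
rewrite [X in _ + X]IH; last by rewrite hx /arity /=; lia.
case: xs => [|y xs] /=.
  by rewrite big_pred0 ?add0r ?isum_nil // => b; rewrite add1n.
under eq_bigl do rewrite add1n eqSS.
rewrite IH; last by rewrite arity_hpcomp; lia.
by rewrite !isum_cons !big_seq1 [in RHS]big_ltn // -[s.+1]addn1.
Qed.

Lemma braceE x xs nd :
  brace x xs nd = isum (hcomp nd) 0 x [seq fsum1 y | y <- xs].
Proof. by rewrite -(@sum_gamma_insertion _ _ (arity x)). Qed.

Definition pieces K (Y : hbim (prodmod P)) : fsum P :=
  (tag Y, [seq piece l Y | l <- index_iota 0 K]).

Lemma homog_pieces K Y : homog (pieces K Y).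
Proof. by apply/allP => y /mapP[l _ ->] /=. Qed.

Lemma sum_pieces_tuple (V : lmodType R) (F : H -> V) K s x Ys :
  \sum_(a : (size Ys).-tuple 'I_K)
    isum F s x [seq fsum1 y | y <- [seq piece ya.2 ya.1 |
                  ya : hbim (prodmod P) * 'I_K <- zip Ys a]] =
  isum F s x [seq pieces K Y | Y <- Ys].
Proof.
elim: Ys s x => [|Y Ys IH] s x.
  rewrite (sum_tuple0 xpredT (fun a => isum F s x
    [seq fsum1 y | y <- [seq piece ya.2 ya.1 |
                  ya : hbim (prodmod P) * 'I_K <- zip [::] a]])) //.
rewrite (sum_tuple_cons (size Ys) xpredT (fun a => isum F s x
    [seq fsum1 y | y <- [seq piece ya.2 ya.1 |
                  ya : hbim (prodmod P) * 'I_K <- zip (Y :: Ys) a]])) /=.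
rewrite isum_cons big_map big_mkord; apply: eq_bigr => c _.
under eq_bigr do rewrite isum_cons big_seq1.
by rewrite exchange_big; apply: eq_bigr => w _; exact: IH.
Qed.

Lemma homog_all K Ys : all (@homog R P) [seq pieces K Y | Y <- Ys].
Proof. by apply/allP => A /mapP[Y _ ->]; exact: homog_pieces. Qed.

Lemma fdeg_pieces K Ys : fdeg [seq pieces K Y | Y <- Ys] = mdeg Ys.
Proof. by rewrite /fdeg big_map. Qed.

Section Vanishing.
Variables (N : nat) (e : bideg).
Local Notation F := (hcomp (N, e) : H -> _).

(** The reasons for which no leaf has arity N and bidegree e. *)
Lemma isum_eq0 s x As : all (@homog R P) As -> (s <= arity x)%N ->
  [|| (N < s)%N, (N + size As < arity x)%N | bdeg x + fdeg As != e] ->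
  isum F s x As = 0.
Proof.
move=> hAs hs h; transitivity (isum (fun=> 0 : ofam P (N, e)) s x As).
  apply: eq_isum_leaf => // y h1 h2 h3; apply: hcomp_neq.
  apply: contraL h => /eqP hy; move: h1 h2 h3; rewrite /arity /bdeg hy /=.
  by move=> h1 h2 <-; rewrite eqxx orbF; lia.
exact: big1.
Qed.

Lemma isum_pieces_stable s x K L Ys :
  (N < K)%N -> (N < L)%N -> (s <= arity x)%N ->
  isum F s x [seq pieces K Y | Y <- Ys] = isum F s x [seq pieces L Y | Y <- Ys].
Proof.
wlog KL : K L / (K <= L)%N.
  move=> h hK hL; case: (leqP K L) => [|/ltnW] hh; first exact: h.
  by move=> hs; rewrite (h L K).
move=> hK hL; elim: Ys s x => [|Y Ys IH] s x hs //=.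
rewrite !isum_cons !big_map [RHS](big_cat_nat (n := K)) //=.
rewrite [X in _ = _ + X]big_nat_cond [X in _ = _ + X]big1 ?addr0.
  apply: eq_bigr => m _; apply: eq_big_nat => w /andP[_ hw].
  by apply: IH; rewrite arity_hpcomp; lia.
move=> m; rewrite andbT => /andP[hm _].
rewrite big_nat_cond big1 // => w; rewrite andbT => /andP[_ hw].
apply: isum_eq0; [exact: homog_all | rewrite arity_hpcomp; lia|].
by apply/or3P/Or31; rewrite /arity /=; lia.
Qed.

End Vanishing.

(** Any truncation bound large enough for arity N gives the same component, so
  one bound can serve for nested braces. *)
Lemma pbraceE K N e X Ys : (N + size Ys < K)%N ->
  hcomp e (pbrace X Ys) N =
  \sum_(x <- (pieces K X).2) isum (hcomp (N, e)) 0 x [seq pieces K Y | Y <- Ys].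
Proof.
move=> hK.
have [he|he] := eqVneq (tag X + mdeg Ys) e; last first.
  rewrite hcomp_neq // big_map big1 // => l _; apply: isum_eq0 => //.
    exact: homog_all.
  by apply/or3P/Or33; rewrite fdeg_pieces.
subst e; rewrite hcomp_el big_map [RHS](big_cat_nat (n := (N + size Ys).+1)) //=.
have -> : \sum_((N + size Ys).+1 <= l < K)
    isum (hcomp (N, tag X + mdeg Ys)) 0 (piece l X) [seq pieces K Y | Y <- Ys]
    = 0.
  rewrite big_nat_cond big1 // => l; rewrite andbT => /andP[hl _].
  apply: isum_eq0 => //; first exact: homog_all.
  by apply/or3P/Or32; rewrite /arity /= size_map.
rewrite addr0.
rewrite big_mkord; apply: eq_bigr => l _.
under eq_bigr do rewrite braceE.
rewrite sum_pieces_tuple; apply: isum_pieces_stable => //.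
by apply: leq_ltn_trans hK; exact: leq_addr.
Qed.

(** A functional that vanishes in arities above N only sees T through its
  components of arity at most N. *)
Lemma sum_pieces (V : lmodType R) (G : H -> V) K N (t : seq H)
    (T : hbim (prodmod P)) :
  hlinear G -> (forall y, (N < arity y)%N -> G y = 0) -> (N < K)%N ->
  homog (tag T, t) ->
  (forall a e, (a <= N)%N ->
     \sum_(y <- t) hcomp (a, e) (y : hop P) = hcomp e T a :> P a e) ->
  \sum_(y <- t) G y = \sum_(y <- (pieces K T).2) G y.
Proof.
move=> Gl G0 hK ht hT.
transitivity (\sum_(y <- t) \sum_(a <- index_iota 0 K)
                G (oel P (hcomp (a, tag T) y : P a (tag T)))).
  apply: eq_big_seq => y /(allP ht) /eqP /= hy.
  have el0 a : a != arity y -> G (oel P (hcomp (a, tag T) y : P a (tag T))) = 0.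
    move=> ha; rewrite hcomp_neq ?(hlinear0 Gl) //.
    by apply: contraNneq ha; rewrite /arity => ->.
  have [hyK|hyK] := ltnP (arity y) K; last first.
    rewrite G0 ?(leq_trans hK) // big_nat_cond big1 // => a; rewrite andbT => ha.
    by apply: el0; lia.
  rewrite (bigD1_seq (arity y)) ?mem_index_iota ?iota_uniq //=.
  rewrite big1 ?addr0 => [|a ha]; last exact: el0.
  rewrite /oel -[hcomp _ _]/(hcomp (arity y, tag T) y) el_hcomp //.
  by rewrite /arity -hy /bdeg; case: (tag y).
rewrite exchange_big big_map /=; apply: eq_bigr => a _.
rewrite -(hlinear_sum Gl); have [ha|ha] := leqP a N; last first.
  by rewrite !G0.
by rewrite hT // hcomp_tag.
Qed.

(** The bridge from formal sums to the product: in a component of arity N, an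
  argument may be any finite formal sum that agrees with T up to arity N. *)
Lemma isum_replace K N e s x As Bs (t : seq H) (T : hbim (prodmod P)) :
  all (@homog R P) As -> all (@homog R P) Bs ->
  homog (tag T, t) -> (N < K)%N -> (s <= arity x)%N ->
  (forall a e, (a <= N)%N ->
     \sum_(y <- t) hcomp (a, e) (y : hop P) = hcomp e T a :> P a e) ->
  isum (hcomp (N, e)) s x (As ++ (tag T, t) :: Bs) =
  isum (hcomp (N, e)) s x (As ++ pieces K T :: Bs).
Proof.
move=> hAs hBs ht hK hs hT.
elim: As hAs s x hs => [|A As IH] /= => [_|/andP[hA hAs]] s x hs; last first.
  rewrite !isum_cons; apply: eq_bigr => y _; apply: eq_big_nat => w /andP[_ hw].
  by apply: IH; rewrite ?arity_hpcomp //; lia.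
rewrite !isum_cons.
apply: (sum_pieces (G := fun y => \sum_(s <= w < arity x)
  isum (hcomp (N, e)) (w + arity y) (hpcomp x w y) Bs) _ _ hK ht hT) => [|y hy].
  move=> [n d] a y y'; rewrite scaler_sumr -big_split /=.
  apply: eq_bigr => w _; rewrite /arity /=.
  apply: (hlinear_hpcompr PP w x (F := fun z => isum _ (w + n) z Bs)).
  exact: (isum_linear PP _ _ (@hlinear_hcomp R _ (ofam P) (N, e))).
rewrite big_nat_cond big1 // => w; rewrite andbT => /andP[_ hw].
apply: isum_eq0 => //; first by rewrite arity_hpcomp; lia.
by apply/or3P/Or31; lia.
Qed.

Lemma homog_inserts s x As : all (@homog R P) As ->
  homog (bdeg x + fdeg As, inserts s x As).
Proof.
elim: As s x => [|A As IH] s x /=.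
  by rewrite /homog /= fdeg_nil addr0 eqxx.
move=> /andP[hA hAs]; apply/allP => e /= /flattenP[l /mapP[y hy ->]].
move=> /flattenP[l' /mapP[w _ ->]] /(allP (IH _ _ hAs)) /=.
by rewrite bdeg_hpcomp fdeg_cons (eqP (allP hA _ hy)) addrA.
Qed.

Lemma isum_flatten (V : lmodType R) (F : H -> V) s x As Bs J (r : seq J) D D'
    (g : J -> seq H) :
  isum F s x (As ++ (D, flatten [seq g j | j <- r]) :: Bs) =
  \sum_(j <- r) isum F s x (As ++ (D' j, g j) :: Bs).
Proof.
elim: As s x => [|A As IH] s x /=.
  rewrite isum_cons big_flatten big_map; apply: eq_bigr => j _.
  by rewrite isum_cons.
rewrite isum_cons; under [RHS]eq_bigr do rewrite isum_cons.
rewrite -(exchange_big21 _ _ (fun=> index_iota s (arity x))).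
by apply: eq_bigr => y _; apply: eq_bigr => w _.
Qed.

End Braces.

(** * Composing braces *)

Section BraceIdentities.
Variables (R : comPzRingType) (P : preoperad R) (PP : operad_axioms P).
Local Notation H := (hop P).
Implicit Types (X Z : hbim (prodmod P)) (Ys : seq (hbim (prodmod P))).

Lemma isum_fsum_sum (V : lmodType R) (F : H -> V) s x As Bs D (t : seq H) :
  isum F s x (As ++ (D, t) :: Bs) =
  \sum_(y <- t) isum F s x (As ++ (0, [:: y]) :: Bs).
Proof.
rewrite -[t in LHS]flatten_seq1.
by rewrite (isum_flatten _ _ _ _ _ _ _ (fun=> 0)).
Qed.

(** A finite formal sum that agrees with pbrace X Ys up to arity K - size Ys - 1. *)
Definition leaves K X Ys : seq H :=
  flatten [seq inserts 0 x [seq pieces K Y | Y <- Ys] | x <- (pieces K X).2].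

Lemma homog_leaves K X Ys : homog (tag (pbrace X Ys), leaves K X Ys).
Proof.
apply/allP => y /flattenP[l /mapP[x /mapP[c _ ->] ->]].
move=> /(allP (homog_inserts _ _ (homog_all _ _))).
by rewrite fdeg_pieces.
Qed.

Lemma sum_leaves (V : lmodType R) (F : H -> V) K X Ys :
  \sum_(y <- leaves K X Ys) F y =
  \sum_(x <- (pieces K X).2) isum F 0 x [seq pieces K Y | Y <- Ys].
Proof. by rewrite /leaves big_flatten big_map. Qed.

Lemma leavesE K N X Ys : (N + size Ys < K)%N -> forall a e, (a <= N)%N ->
  \sum_(y <- leaves K X Ys) hcomp (a, e) (y : hop P) =
  hcomp e (pbrace X Ys) a :> P a e.
Proof. by move=> hK a e ha; rewrite sum_leaves (pbraceE PP (K := K)) //; lia. Qed.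

Lemma pbrace_leavesl K N e X Ys Ws : (N + size Ws + size Ys < K)%N ->
  hcomp e (pbrace (pbrace X Ys) Ws) N =
  \sum_(x <- (pieces K X).2)
    isum (fun y => isum (hcomp (N, e)) 0 y [seq pieces K W | W <- Ws])
      0 x [seq pieces K Y | Y <- Ys].
Proof.
move=> hK; rewrite (pbraceE PP (K := K)); last by lia.
rewrite -[RHS]sum_leaves; apply/esym.
apply: (sum_pieces (N := (N + size Ws)%N)) => [|y hy|||]; last first.
- exact: leavesE.
- exact: homog_leaves.
- lia.
- apply: isum_eq0 => //; first exact: homog_all.
  by apply/or3P/Or32; rewrite size_map.
- by apply: (isum_linear PP); exact: (@hlinear_hcomp R _ (ofam P) (N, e)).
Qed.

Lemma pbrace_leavesr K N e X Z Ws Ys Us : (N + size Ys < K)%N ->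
  (N + (size Ws + size Us).+1 < K)%N ->
  hcomp e (pbrace X (Ws ++ pbrace Z Ys :: Us)) N =
  \sum_(x <- (pieces K X).2) isum (hcomp (N, e)) 0 x
    ([seq pieces K W | W <- Ws] ++ (tag Z + mdeg Ys, leaves K Z Ys)
       :: [seq pieces K U | U <- Us]).
Proof.
move=> hK hK'; rewrite (pbraceE PP (K := K)); last by rewrite size_cat /=; lia.
apply: eq_bigr => x _; rewrite map_cat /=.
rewrite -(@isum_replace _ _ PP K N e 0 x _ _ (leaves K Z Ys) (pbrace Z Ys)) //.
- exact: homog_all.
- exact: homog_all.
- exact: homog_leaves.
- lia.
- exact: leavesE.
Qed.

Lemma pbrace_pbrace1 N e X Z Ys :
  hcomp e (pbrace (pbrace X [:: Z]) Ys) N =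
  \sum_(0 <= r < (size Ys).+1) \sum_(0 <= q < (size Ys - r).+1)
    sgn (bipair (tag Z) (mdeg (take r Ys))) *:
    (hcomp e (pbrace X (take r Ys ++ pbrace Z (take q (drop r Ys))
                          :: drop (r + q) Ys)) N : P N e).
Proof.
(* Large enough for both levels of nesting on either side. *)
pose K := (N + size Ys + 3)%N.
rewrite (pbrace_leavesl (K := K)) /=; last by rewrite /K; lia.
set A := [seq pieces K W | W <- Ys].
transitivity (\sum_(x <- (pieces K X).2) \sum_(z <- (pieces K Z).2)
  \sum_(0 <= r < (size A).+1) \sum_(0 <= q < (size A - r).+1)
    sgn (bipair (tag Z) (fdeg (take r A))) *:
    isum (hcomp (N, e)) 0 x (take r A ++
      (bdeg z + fdeg (take q (drop r A)), inserts 0 z (take q (drop r A)))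
      :: drop (r + q) A)).
  apply: eq_bigr => x _; rewrite isum_cons; apply: eq_big_seq => z hz.
  under eq_bigr do rewrite isum_nil.
  rewrite (isum_hpcomp PP (@hlinear_hcomp R _ (ofam P) (N, e)));
    last exact: homog_all.
  by rewrite (eqP (allP (homog_pieces K Z) _ hz)).
rewrite (exchange_big22 _ _ (fun=> (pieces K Z).2)
  (fun r => index_iota 0 (size A - r).+1)) size_map.
apply: eq_big_nat => r hr; apply: eq_big_nat => q hq.
rewrite (pbrace_leavesr (K := K)).
- rewrite scaler_sumr; apply: eq_bigr => x _.
  rewrite -scaler_sumr /A -!map_take -!map_drop fdeg_pieces; congr (_ *: _).
  rewrite /leaves (isum_flatten _ _ _ _ _ _ _
       (fun z => bdeg z + fdeg [seq pieces K W | W <- take q (drop r Ys)])).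
  by apply: eq_bigr => z _; rewrite -!map_take.
- by rewrite size_take size_drop /K; case: ifP; lia.
- rewrite size_take size_drop /K; case: ifP; lia.
Qed.

Lemma pbrace1_pbrace N e X Z Ys (x0 : hbim (prodmod P)) :
  hcomp e (pbrace (pbrace X Ys) [:: Z]) N =
  \sum_(0 <= r < (size Ys).+1) sgn (bipair (tag Z) (mdeg (drop r Ys))) *:
    (hcomp e (pbrace X (take r Ys ++ Z :: drop r Ys)) N : P N e) +
  \sum_(0 <= r < size Ys) sgn (bipair (tag Z) (mdeg (drop r.+1 Ys))) *:
    (hcomp e (pbrace X (take r Ys ++ pbrace (nth x0 Ys r) [:: Z]
                          :: drop r.+1 Ys)) N : P N e).
Proof.
pose K := (N + size Ys + 3)%N.
rewrite (pbrace_leavesl (K := K)) /=; last by rewrite /K; lia.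
set A := [seq pieces K W | W <- Ys].
transitivity (\sum_(x <- (pieces K X).2) \sum_(z <- (pieces K Z).2)
  (\sum_(0 <= r < (size A).+1) sgn (bipair (tag Z) (fdeg (drop r A))) *:
     isum (hcomp (N, e)) 0 x (take r A ++ (bdeg z, [:: z]) :: drop r A) +
   \sum_(0 <= r < size A) sgn (bipair (tag Z) (fdeg (drop r.+1 A))) *:
     isum (hcomp (N, e)) 0 x (take r A ++ fsum_pcomp (nth (0, [::]) A r) z
                   :: drop r.+1 A))).
  apply: eq_bigr => x _.
  transitivity (isum (fun y => \sum_(z <- (pieces K Z).2)
     \sum_(0 <= v < arity y) hcomp (N, e) (hpcomp y v z)) 0 x A).
    apply: eq_isum => y; rewrite isum_cons; apply: eq_bigr => z _.
    by apply: eq_bigr => v _; rewrite isum_nil.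
  rewrite isum_sum; apply: eq_big_seq => z hz.
  rewrite (hpcomp_isum PP (@hlinear_hcomp R _ (ofam P) (N, e))) //;
    last exact: homog_all.
  by rewrite (eqP (allP (homog_pieces K Z) _ hz)).
rewrite big_split2 !(exchange_big21 _ _ (fun=> (pieces K Z).2)) size_map.
congr (_ + _); apply: eq_big_nat => r hr.
- rewrite (pbraceE PP (K := K)); last first.
    by rewrite size_cat /= size_take size_drop /K; case: ifP; lia.
  rewrite scaler_sumr; apply: eq_bigr => x _; rewrite -scaler_sumr.
  rewrite map_cat /= /A -!map_take -!map_drop fdeg_pieces; congr (_ *: _).
  have -> : pieces K Z = (tag Z, flatten [seq [:: z] | z <- (pieces K Z).2]).
    by rewrite /pieces flatten_seq1.
  by rewrite (isum_flatten _ _ _ _ _ _ _ (@bdeg R P)).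
- rewrite (pbrace_leavesr (K := K)); last first.
  + by rewrite size_take size_drop /K; case: ifP; lia.
  + by rewrite /K /=; lia.
  rewrite scaler_sumr; apply: eq_bigr => x _; rewrite -scaler_sumr.
  rewrite /A -!map_take -!map_drop fdeg_pieces; congr (_ *: _).
  rewrite (nth_map x0) //.
  rewrite isum_fsum_sum sum_leaves.
  under eq_bigr do rewrite isum_fsum_sum big_flatten big_map.
  rewrite exchange_big; apply: eq_bigr => y _.
  rewrite isum_cons; apply: eq_bigr => z _.
  by rewrite big_map; apply: eq_bigr => j _; rewrite isum_nil.
Qed.

Lemma pbrace_nil Z : pbrace Z [::] = Z.
Proof.
have hd : tag Z + mdeg ([::] : seq (hbim (prodmod P))) = tag Z.
  by rewrite mdeg0 addr0.
apply: el_ext => // e; apply: functional_extensionality_dep => N.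
rewrite (pbraceE PP (K := N.+1)) ?addn0 // big_map.
under eq_bigr do rewrite isum_nil.
rewrite (bigD1_seq N) ?mem_index_iota ?iota_uniq //= big1 => [|l hl]; last first.
  by rewrite hcomp_neq //; apply: contraNneq hl => -[->].
rewrite addr0; have [<-|he] := eqVneq (tag Z) e.
  by rewrite hcomp_tag /piece /oel hcomp_el.
by rewrite !hcomp_neq //; apply: contraNneq he => -[->].
Qed.

Lemma isum_piecesr_linear (V : lmodType R) (F : H -> V) K s x As Bs :
  hlinear F -> hlinear (fun T => isum F s x (As ++ pieces K T :: Bs)).
Proof.
move=> Fl d a y z; elim: As s x => [|A As IH] s x /=; last first.
  rewrite !isum_cons scaler_sumr -big_split; apply: eq_bigr => b _ /=.
  by rewrite scaler_sumr -big_split; apply: eq_bigr => w _ /=.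
rewrite !isum_cons !big_map scaler_sumr -big_split; apply: eq_bigr => m _ /=.
rewrite scaler_sumr -big_split; apply: eq_bigr => w _ /=.
rewrite /arity /=.
have Gl : hlinear (fun b => isum F (w + m) (hpcomp x w b) Bs).
  exact: (hlinear_hpcompr PP w x (isum_linear PP (w + m) Bs Fl)).
exact: (Gl (m, d) a (y m) (z m)).
Qed.

Lemma pbrace_linr N e X Ys (Ws : seq (hbim (prodmod P))) :
  hlinear (fun T : hbim (prodmod P) =>
    hcomp e (pbrace X (Ys ++ T :: Ws)) N : P N e).
Proof.
move=> d a y z; pose K := (N + size Ys + size Ws + 2)%N.
have hK (T : hbim (prodmod P)) : (N + size (Ys ++ T :: Ws) < K)%N. 
  by rewrite size_cat /= /K; lia.
rewrite !(pbraceE PP _ _ (hK _)) scaler_sumr -big_split; apply: eq_bigr => x _.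
rewrite !map_cat /=.
exact: (isum_piecesr_linear _ _ _ _ _ (@hlinear_hcomp R _ (ofam P) (N, e))).
Qed.

Lemma pbrace_linl N e Ys : hlinear (fun T => hcomp e (pbrace T Ys) N : P N e).
Proof.
move=> d a y z; rewrite !(pbraceE PP (K := (N + size Ys).+1)) //.
rewrite !big_map scaler_sumr -big_split; apply: eq_bigr => l _ /=.
have Fl := isum_linear PP 0 [seq pieces (N + size Ys).+1 Y | Y <- Ys]
  (@hlinear_hcomp R _ (ofam P) (N, e)).
exact: (Fl (l, d) a (y l) (z l)).
Qed.

(** In arity N, a slot r and an arity q + 1 for the inserted operation leave
  N - q as the arity of the outer one; this is the indexing of the structure
  equations after Ainf_sumE. *)
Lemma pbrace1E (X Z : hbim (prodmod P)) N e : tagged Z 0%N = 0 ->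
  hcomp e (pbrace X [:: Z]) N =
  \sum_(0 <= r < N) \sum_(0 <= q < N - r)
    hcomp (N, e) (hpcomp (piece (N - q) X) r (piece q.+1 Z)) :> P N e.
Proof.
move=> Z0; rewrite (pbraceE PP (K := N.+2)) ?addn1 // big_map.
transitivity (\sum_(0 <= q < N.+2) \sum_(0 <= j < N.+2) \sum_(0 <= r < j)
    hcomp (N, e) (hpcomp (piece j X) r (piece q Z))).
  rewrite exchange_big; apply: eq_bigr => j _.
  rewrite isum_cons big_map; apply: eq_bigr => q _; apply: eq_bigr => r _.
  by rewrite isum_nil.
rewrite big_nat_recl // big1 ?add0r => [|j _]; last first.
  apply: big1 => r _; rewrite /piece Z0.
  exact: (hlinear0 (hlinear_hpcompr PP r _ (@hlinear_hcomp R _ (ofam P) (N, e)))).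
transitivity (\sum_(0 <= q < N.+1) \sum_(0 <= r < N - q)
    hcomp (N, e) (hpcomp (piece (N - q) X) r (piece q.+1 Z))).
  apply: eq_big_nat => q /andP[_ hq].
  rewrite (bigD1_seq (N - q)%N) ?mem_index_iota ?iota_uniq //=; last by lia.
  rewrite [X in _ + X]big1 ?addr0 // => j hj.
  apply: big1 => r _; apply: hcomp_neq.
  by apply: contraNneq hj => -[] /=; lia.
rewrite big_nat_recr //= subnn [X in _ + X]big_geq // addr0.
by rewrite sum_antidiag.
Qed.

End BraceIdentities.

(** * The operadic suspension of an operad *)

Section Suspension.
Variables (R : comPzRingType) (O : operad R).
Local Notation sO := (osusp O).

Lemma ecast_lin n d d' (h : d = d') a (x y : O n d) :
  ecast d (O n d) h (a *: x + y) = a *: ecast d (O n d) h x + ecast d (O n d) h y.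
Proof. by case: _ / h. Qed.

Lemma oel_ecast n d d' (h : d = d') (x : O n d) :
  oel O (ecast d (O n d) h x) = oel O x.
Proof. by case: _ / h. Qed.

(** The suspension has the modules of O in shifted bidegrees.  Its laws are
  proved by forgetting the shift. *)
Definition unsusp (h : hop sO) : hop O :=
  @oel _ O (tag h).1 ((tag h).2 - (0, (tag h).1%:Z - 1)) (tagged h).

Lemma unsusp_inj : injective unsusp.
Proof.
move=> [[n d] x] [[n' d'] x'] e.
have et := congr1 (@tag _ _) e.
have /= en : n = n' := congr1 fst et; subst n'.
have /= /addIr ed := congr1 snd et; subst d'.
have ex : x = x'; last by rewrite ex.
by have := congr1 (hcomp (n, d - (0, n%:Z - 1))) e; rewrite !hcomp_el.
Qed.

Lemma arity_unsusp h : arity (unsusp h) = arity h.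
Proof. by []. Qed.

Lemma bdeg_unsusp h : bdeg (unsusp h) = bdeg h - (0, (arity h)%:Z - 1).
Proof. by []. Qed.

Lemma unsusp_hsc a h : unsusp (hsc a h) = hsc a (unsusp h).
Proof. by []. Qed.

Definition susp_sgn (x : hop sO) s (y : hop sO) : R :=
  sgn (((arity x)%:Z - 1) * ((bdeg y).2 - ((arity y)%:Z - 1))
       + ((arity x)%:Z - 1) * ((arity y)%:Z - 1) + s%:Z * ((arity y)%:Z - 1)).

Lemma susp_sgnE x s y : susp_sgn x s y =
  sgn (((arity x)%:Z - 1) * (bdeg y).2 + s%:Z * ((arity y)%:Z - 1)).
Proof. by congr sgn; ring. Qed.

Lemma unsusp_hpcomp x s y : (s < arity x)%N ->
  unsusp (hpcomp x s y) = hsc (susp_sgn x s y) (hpcomp (unsusp x) s (unsusp y)).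
Proof.
case: x y => [[n d] x] [[m e] y]; rewrite /arity /= => hs.
rewrite -!/(oel sO _) !hpcomp_oel.
have -> : unsusp (oel sO (Defs.pcomp (Ordinal hs) x y)) =
  hsc (susp_sgn (oel sO x) s (oel sO y))
    (oel O (ecast d (O _ d) (susp_deg_comp m d e (Ordinal hs))
       (Defs.pcomp (p := O) (Ordinal hs) x y))) by [].
by rewrite oel_ecast -hpcomp_oel.
Qed.

(** The sign of the suspended composition reduces to the parity of
  (n - 1) e.2 + r (m - 1), with e the natural bidegree of y.  The discrepancies
  between these signs on the two sides of an associativity law are constant in
  the sequential case, and in the parallel case they turn the Koszul sign of
  the bidegrees in O into that of the natural bidegrees. *)
Lemma osusp_operad : operad_axioms sO.
Proof.
have OP := operadP O.
split.
- move=> n m d e r a x x' y /=.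
  by rewrite (pcomp_linl OP) ecast_lin scalerDr !scalerA mulrC.
- move=> n m d e r a x y y' /=.
  by rewrite (pcomp_linr OP) ecast_lin scalerDr !scalerA mulrC.
- move=> m e y; apply: unsusp_inj.
  rewrite oel_pcomp.
  rewrite unsusp_hpcomp //.
  have -> : unsusp (oel sO (oone sO)) = oel O (oone O) by exact: oel_ecast.
  rewrite (hpcomp_1l OP).
  by rewrite /susp_sgn /arity /= subrr !mul0r !addr0 sgn0 hsc1.
- move=> n d r x; apply: unsusp_inj.
  rewrite oel_pcomp.
  rewrite unsusp_hpcomp ?ltn_ord //.
  have -> : unsusp (oel sO (oone sO)) = oel O (oone O) by exact: oel_ecast.
  rewrite (hpcomp_1r OP); last by rewrite arity_unsusp ltn_ord.
  rewrite /susp_sgn -[arity (oel sO (oone sO))]/1%N.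
  rewrite -[(bdeg (oel sO (oone sO))).2]/(0 : int) (subrr 1) subr0.
  by rewrite !mulr0 !addr0 sgn0 hsc1.
- move=> n m k d e f x y z r s w hw; apply: unsusp_inj.
  have hr := ltn_ord r; have hs := ltn_ord s.
  rewrite !oel_pcomp hw.
  rewrite !unsusp_hpcomp ?arity_hpcomp -?hw ?ltn_ord // hw.
  rewrite (hpcomp_hscl OP) (hpcomp_hscr OP) !hscA (hpcomp_seq OP) ?ltn_ord //.
  congr hsc; rewrite !susp_sgnE -!sgnD; apply: eq_sgn.
  rewrite !arity_hpcomp bdeg_hpcomp.
  rewrite -![arity (oel sO x)]/n -![arity (oel sO y)]/m -![arity (oel sO z)]/k.
  rewrite -?[bdeg (oel sO y)]/e -?[bdeg (oel sO z)]/f.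
  rewrite -[(e + f).2]/(e.2 + f.2) !predz_addn; [|lia|lia].
  by rewrite PoszD; parity.
- move=> n m k d e f x y z r s w w' hrs hw hw'; apply: unsusp_inj.
  rewrite -[RHS]/(unsusp (hsc (sgn (bipair e f))
    (oel sO (Defs.pcomp w' (Defs.pcomp s x z) y)))).
  rewrite !oel_pcomp hw hw' unsusp_hsc.
  have hs := ltn_ord s; have hr : (r < n)%N by lia.
  rewrite !unsusp_hpcomp // ?arity_hpcomp /arity /=; [|lia|lia].
  rewrite !(hpcomp_hscl OP) !hscA (hpcomp_par OP) // hscA.
  congr hsc; rewrite !susp_sgnE -!sgnD; apply: eq_sgn.
  rewrite !arity_hpcomp !bdeg_unsusp.
  rewrite -![arity (oel sO x)]/n -![arity (oel sO y)]/m -![arity (oel sO z)]/k.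
  rewrite -?[bdeg (oel sO y)]/e -?[bdeg (oel sO z)]/f.
  rewrite !predz_addn; [|lia|lia|lia].
  rewrite /bipair -[(e - _).1]/(e.1 - 0) -[(f - _).1]/(f.1 - 0).
  rewrite -[(e - _).2]/(e.2 - (m%:Z - 1)) -[(f - _).2]/(f.2 - (k%:Z - 1)) !subr0.
  by parity.
Qed.

End Suspension.

(** * The index set of the structure equations *)

Section AinfSum.
Variables (R : comPzRingType) (V : lmodType R).

Lemma Ainf_inner_sum v (f : nat -> nat -> nat -> nat -> V) :
  \sum_(j < v.+1 | (0 < j)%N)
    \sum_(q < v.+1 | (0 < q)%N && (v == (j + q - 1)%N))
    \sum_(r < j) \sum_(t < j | j == (r + 1 + t)%N :> nat) f j q r t =
  \sum_(0 <= r < v) \sum_(0 <= q < v - r)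
    f (v - q)%N q.+1 r (v - q - r).-1.
Proof.
transitivity (\sum_(j < v.+1 | (0 < j)%N)
    \sum_(q < v.+1 | (0 < q)%N && (v == (j + q - 1)%N))
    \sum_(0 <= r < j) f j q r (j - r).-1).
  apply: eq_bigr => j _; apply: eq_bigr => q _; rewrite big_mkord.
  apply: eq_bigr => r _; have hr := ltn_ord r.
  rewrite (eq_bigl (fun t : 'I_j => t == (j - r).-1 :> nat)).
    by rewrite big_ord1_eq ifT //; lia.
  by move=> t /=; lia.
rewrite (exchange_big_dep (fun q : 'I_v.+1 => 0 < q)%N) /=; last first.
  by move=> j q _ /andP[].
transitivity (\sum_(q < v.+1 | (0 < q)%N)
   \sum_(0 <= r < v.+1 - q) f (v.+1 - q)%N q r (v.+1 - q - r).-1).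
  apply: eq_bigr => q hq; have hqv := ltn_ord q.
  rewrite (eq_bigl (fun j : 'I_v.+1 => j == (v.+1 - q)%N :> nat)).
    rewrite (big_ord1_eq _ (fun j => \sum_(0 <= r < j) f j q r (j - r).-1)).
    by rewrite ifT //; lia.
  by move=> j /=; lia.
rewrite big_mkcond big_ord_recl /= add0r -sum_antidiag big_mkord.
by apply: eq_bigr => q _; rewrite /bump /= add1n subSS.
Qed.

(** The free indices are p, r and the number q of inputs of the inner map minus
  one; then i = u - p, j = v - q and t = v - q - r - 1. *)
Lemma Ainf_sumE u v (G : nat -> nat -> nat -> nat -> nat -> V) :
  Ainf_sum u v (fun i j p q r => G i j p q r) =
  \sum_(0 <= p < u.+1) \sum_(0 <= r < v) \sum_(0 <= q < v - r)
    (-1) ^+ (r * q.+1 + (v - q - r).-1 + p * (v - q)) *: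
      G (u - p)%N (v - q)%N p q.+1 r.
Proof.
rewrite /Ainf_sum.
rewrite (exchange_big_dep xpredT) //= big_mkord; apply: eq_bigr => p _.
rewrite (eq_bigl (fun i : 'I_u.+1 => i == (u - p)%N :> nat)); last first.
  by move=> i; have := ltn_ord p; have := ltn_ord i; lia.
under eq_bigr => i _ do rewrite (Ainf_inner_sum v (fun j q r t =>
  (-1) ^+ (r * q + t + p * j) *: G i j p q r)).
rewrite (big_ord1_eq _ (fun i => \sum_(0 <= r < v) \sum_(0 <= q < v - r)
    (-1) ^+ (r * q.+1 + (v - q - r).-1 + p * (v - q)) *:
      G i (v - q)%N p q.+1 r)).
by rewrite ifT // ltnS leq_subr.
Qed.

End AinfSum.

(** * The unshifted structure maps square to zero *)

Section Core.
Variables (R : comPzRingType) (O : operad R).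
Variable m : forall i j : nat, O j (i%:Z, 2 - i%:Z - j%:Z).
Hypothesis m_mult : derived_Ainf_multiplication m.
Local Notation Q := (osusp O).
Local Notation B := (prodmod Q).
Local Notation PQ := (osusp_operad O).
Local Notation M i := (mult_row m i).
Implicit Types (ys : seq (hbim B)) (e : bideg) (N : nat).

Definition mbideg (i : nat) : bideg := (i%:Z, 1 - i%:Z).

Lemma sgn_mbideg i p :
  (-1) ^+ p * sgn (bipair (mbideg i) (mbideg p)) = - (-1) ^+ i :> R.
Proof.
rewrite -[(-1 : R) ^+ p]/(sgn p%:Z) -[(-1 : R) ^+ i]/(sgn i%:Z) -mulN1r.
by rewrite -[-1 : R]/(sgn 1) -!sgnD; apply: eq_sgn; rewrite /bipair /=; parity.
Qed.

Lemma hcomp_unsusp N e (h : hop Q) :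
  hcomp (N, e) h = hcomp (N, e - (0, N%:Z - 1)) (unsusp h) :> O N _.
Proof.
case: h => [[n d] x]; have [[en ed]|ne] := eqVneq (n, d) (N, e).
  by subst n d; rewrite !hcomp_el.
rewrite !hcomp_neq //; apply: contraNneq ne => h.
have /= en := congr1 fst h; have /= := congr1 snd h.
by rewrite en => /addIr ->.
Qed.

Lemma unsusp_mult_row i j : (0 < j)%N -> unsusp (piece j (M i)) = oel O (m i j).
Proof.
move=> hj; rewrite -[LHS]/(oel O (if (0 < j)%N
  then ecast d (O j d) (susp_deg_mult i j) (m i j) else 0)).
by rewrite hj oel_ecast.
Qed.

(** The signs of the suspended compositions of the m_{ij} differ from those of
  the structure equation by (-1)^p. *)
Lemma mult_relation u N e :
  \sum_(0 <= p < u.+1)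
    (-1) ^+ p *: (hcomp e (pbrace (M (u - p)) [:: M p]) N : Q N e) = 0.
Proof.
have [->|N_gt0] := posnP N.
  by apply: big1 => p _; rewrite (pbrace1E PQ) // big_geq // scaler0.
have := m_mult u N_gt0 (e - (0, N%:Z - 1)).
have -> : (fun i j p q (r : 'I_j) =>
    hcomp (N, e - (0, N%:Z - 1)) (oel O (Defs.pcomp r (m i j) (m p q)))) =
  (fun i j p q (r : 'I_j) => hcomp (N, e - (0, N%:Z - 1))
     (hpcomp (oel O (m i j)) r (oel O (m p q)))).
  do 5 (apply: functional_extensionality_dep => ?).
  by rewrite oel_pcomp.
rewrite (Ainf_sumE u N (fun i j p q r => hcomp (N, e - (0, N%:Z - 1))
     (hpcomp (oel O (m i j)) r (oel O (m p q))))) => h.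
rewrite -[RHS]h; apply: eq_bigr => p _.
rewrite (pbrace1E PQ) // scaler_sumr; apply: eq_big_nat => r /andP[_ hr].
rewrite scaler_sumr; apply: eq_big_nat => q /andP[_ hq].
have [t ht] : exists t, (N - q = (r + t).+1)%N by exists (N - q - r).-1; lia.
rewrite hcomp_unsusp unsusp_hpcomp; last by rewrite /arity /= ht; lia.
rewrite !unsusp_mult_row ?ht //.
rewrite (hlinearZ (@hlinear_hcomp R _ (ofam O) _)) scalerA; congr (_ *: _).
rewrite susp_sgnE -[(-1) ^+ p]/(sgn p%:Z) -[(-1) ^+ _]/(sgn (_%:Z)) -sgnD.
apply: eq_sgn.
rewrite -[arity _]/(r + t).+1 -[arity _]/q.+1 -[(bdeg _).2]/(1 - p%:Z).
have -> : ((r + t).+1 - r).-1 = t by lia.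
by rewrite !(PoszD, PoszM, intS); parity.
Qed.

Lemma mult_relation_hlinear u (V : lmodType R) (G : hbim B -> V) : hlinear G ->
  \sum_(0 <= p < u.+1) (-1) ^+ p *: G (pbrace (M (u - p)) [:: M p]) = 0.
Proof.
move=> Gl; pose D : bideg := (u%:Z, 2 - u%:Z).
have tagE p : (p < u.+1)%N -> tag (pbrace (M (u - p)) [:: M p]) = D.
  move=> hp; rewrite /= /mdeg big_seq1 /=.
  rewrite -[LHS]/(_%:Z + p%:Z, 1 - _%:Z + (1 - p%:Z)).
  by congr pair; lia.
transitivity (\sum_(0 <= p < u.+1)
    (-1) ^+ p *: G (el B (hcomp D (pbrace (M (u - p)) [:: M p])))).
  by apply: eq_big_nat => p /andP[_ hp]; rewrite el_hcomp ?tagE.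
rewrite (hlinear_comb Gl (i := D)) //=.
rewrite (_ : \sum_(_ <- _) _ = 0) ?(hlinear0 Gl) //.
apply: functional_extensionality_dep => N; rewrite dprod_sumE.
rewrite -[RHS](mult_relation u N D); apply: eq_bigr => p _.
by rewrite hcomp_el.
Qed.

Definition on_singleton (T : Type) (V : nmodType) (L : seq T) (f : T -> V) : V :=
  if L is [:: y] then f y else 0.

Lemma on_singleton0 (T : Type) (V : nmodType) (L : seq T) (f : T -> V) :
  size L != 1%N -> on_singleton L f = 0.
Proof. by case: L => [|? []]. Qed.

(** The structure maps on the product before shifting, without the sign in front
  of the brace; on_singleton adds the second term of the arity-one map. *)
Definition brace_op i ys : hbim B :=
  el B (i := mdeg ys + mbideg i) (hcomp _ (pbrace (M i) ys) -
    on_singleton ys (fun y =>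
      sgn (bipair (mbideg i) (tag y)) *: hcomp _ (pbrace y [:: M i]))).

Lemma brace_op_hlinear (V : lmodType R) (F : hbim B -> V) i ys : hlinear F ->
  F (brace_op i ys) = F (pbrace (M i) ys) - on_singleton ys (fun y =>
      sgn (bipair (mbideg i) (tag y)) *: F (pbrace y [:: M i])).
Proof.
move=> Fl; rewrite /brace_op.
have tagM : tag (pbrace (M i) ys) = mdeg ys + mbideg i by rewrite addrC.
case: ys tagM => [|y [|y' ys]] tagM /=; rewrite ?subr0 ?el_hcomp //.
rewrite [hcomp _ _ - _]addrC -scaleNr Fl scaleNr addrC !el_hcomp //.
by rewrite /= !mdeg1.
Qed.

Section Square.
Variables (u : nat) (ys : seq (hbim B)) (e : bideg) (N : nat).
Hypothesis ys_gt0 : (0 < size ys)%N.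
Local Notation n := (size ys).
Let c (T : hbim B) : Q N e := hcomp e T N.
(** A default value for nth, which is never reached. *)
Let y0 : hbim B := M 0.
Let s p r : R := sgn (bipair (mbideg p) (mdeg (take r ys))).

(** The parts of the expanded sum: S1 has plain braces for both maps, S2 the
  correction of an inner map with one input, S3 and S4 the two terms of an outer
  map whose single input is the value of the inner map on ys.  The terms Q0, in
  which m_p is inserted among ys, only appear in the expansions. *)
Let S1 p := \sum_(0 <= r < n) \sum_(0 <= q < n - r) s p r *:
  c (pbrace (M (u - p)) (take r ys ++ pbrace (M p) (take q.+1 (drop r ys))
                           :: drop (r + q.+1) ys)).
Let Q0 p := \sum_(0 <= r < n.+1) s p r *:
  c (pbrace (M (u - p)) (take r ys ++ M p :: drop r ys)).
Let S2 p := \sum_(0 <= r < n) s p r.+1 *: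
  c (pbrace (M (u - p)) (take r ys ++ pbrace (nth y0 ys r) [:: M p]
                           :: drop r.+1 ys)).
Let S3 p := sgn (bipair (mbideg (u - p)) (mbideg p + mdeg ys)) *:
  c (pbrace (pbrace (M p) ys) [:: M (u - p)]).
Let S4 p := on_singleton ys (fun y =>
  (sgn (bipair (mbideg (u - p)) (mbideg p + mdeg ys))
     * sgn (bipair (mbideg p) (tag y))) *:
  c (pbrace (pbrace y [:: M p]) [:: M (u - p)])).

Let c_linear : hlinear c.
Proof. by move=> d a x y; rewrite /c (hlinear_hcomp e). Qed.

Let c_linl zs : hlinear (fun T => c (pbrace T zs)).
Proof. exact: (pbrace_linl PQ). Qed.

Let c_linr X zs ws : hlinear (fun T => c (pbrace X (zs ++ T :: ws))).
Proof. exact: (pbrace_linr PQ). Qed.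

(** The braces of sum_p (-1)^p b_1(m_{u-p}; m_p) = 0 with ys; the summands with
  q = 0 in pbrace_pbrace1 make up Q0. *)
Let S1_Q0 : \sum_(0 <= p < u.+1) (-1) ^+ p *: (S1 p + Q0 p) = 0.
Proof.
transitivity (\sum_(0 <= p < u.+1)
   (-1) ^+ p *: c (pbrace (pbrace (M (u - p)) [:: M p]) ys)).
  apply: eq_bigr => p _; congr (_ *: _).
  rewrite /c (pbrace_pbrace1 PQ) -/c addrC.
  under [RHS]eq_bigr do rewrite big_nat_recl //=.
  rewrite big_split /=; congr (_ + _).
    apply: eq_bigr => r _; rewrite take0 pbrace_nil ?addn0 //.
    exact: PQ.
  rewrite [RHS]big_nat_recr //= subnn.
  by rewrite (_ : \sum_(0 <= q < 0) _ = 0) ?addr0 //; exact: big_geq.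
exact: mult_relation_hlinear (c_linl ys).
Qed.

(** Exchanging the roles of p and u - p identifies the expansion of S3 with
  Q0 + S2, and sgn_mbideg produces the minus sign. *)
Let S3E : \sum_(0 <= p < u.+1) (-1) ^+ p *: S3 p =
  - \sum_(0 <= p < u.+1) (-1) ^+ p *: (Q0 p + S2 p).
Proof.
rewrite [in RHS]big_nat_rev /= -sumrN; apply: eq_big_nat => p /andP[_ hp].
have up : (u - (u - p) = p)%N by lia.
rewrite add0n subSS /S3 /c (pbrace1_pbrace PQ _ _ _ _ _ y0) -/c /Q0 /S2 up.
have sg zs ws : ys = zs ++ ws ->
    (-1) ^+ p * (sgn (bipair (mbideg (u - p)) (mbideg p + mdeg ys))
        * sgn (bipair (mbideg (u - p)) (mdeg ws))) =
    - ((-1) ^+ (u - p) * sgn (bipair (mbideg (u - p)) (mdeg zs))) :> R.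
  move=> ->; rewrite mdeg_cat !sgn_bipairDr -!mulrA sgn_sqr mulr1 mulrA.
  by rewrite sgn_mbideg mulNr.
rewrite scalerA scalerDr !scaler_sumr scalerDr !scaler_sumr opprD -!sumrN.
congr (_ + _); apply: eq_bigr => r _.
  by rewrite !scalerA -mulrA (sg (take r ys)) ?cat_take_drop // scaleNr.
by rewrite !scalerA -mulrA (sg (take r.+1 ys)) ?cat_take_drop // scaleNr.
Qed.

(** Only for one input y.  Expanding gives the two orders of insertion of m_p and
  m_{u-p} into y, which cancel after exchanging p and u - p, and the insertion
  of b_1(m_p; m_{u-p}), which vanishes by the relation satisfied by m. *)
Let S4E : \sum_(0 <= p < u.+1) (-1) ^+ p *: S4 p = 0.
Proof.
rewrite /S4; case: (ys) => [|y [|y' ys']] /=;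
  try by apply: big1 => p _; rewrite scaler0.
pose w p := c (pbrace y [:: M p; M (u - p)]).
pose C : R := sgn (bipair (u%:Z, 2 - u%:Z) (tag y)).
transitivity (\sum_(0 <= p < u.+1) (- C * (-1) ^+ (u - p)) *:
    (sgn (bipair (mbideg (u - p)) (mbideg p)) *: w (u - p)%N + w p
     + c (pbrace y [:: pbrace (M p) [:: M (u - p)]]))).
  apply: eq_big_nat => p /andP[_ hp].
  have up : (u - (u - p) = p)%N by lia.
  rewrite /c (pbrace1_pbrace PQ _ _ _ _ _ y0) -/c /= big_nat_recl // !big_nat1.
  rewrite /= mdeg1 /mdeg big_nil bipair0 sgn0 !scale1r -/(mdeg _) mdeg1.
  rewrite /w up scalerA; congr (_ *: _).
  rewrite sgn_bipairDr ?mdeg1 !mulrA sgn_mbideg !mulNr -mulrA -sgnD -bipairDl.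
  rewrite mulrC; congr (- (sgn (bipair _ _) * _)).
  by rewrite -[LHS]/(_%:Z + p%:Z, 1 - _%:Z + (1 - p%:Z)); congr pair; lia.
rewrite big_nat_rev /= add0n.
transitivity (\sum_(0 <= p < u.+1) (C * (-1) ^+ (u - p)) *: w p
  + \sum_(0 <= p < u.+1) (- C * (-1) ^+ p) *: w (u - p)%N
  - C *: \sum_(0 <= p < u.+1) (-1) ^+ p *:
      c (pbrace y [:: pbrace (M (u - p)) [:: M p]])).
  rewrite scaler_sumr -sumrN -!big_split; apply: eq_big_nat => p /andP[_ hp].
  have up : (u - (u - p) = p)%N by lia.
  rewrite /= subSS up !scalerDr !scalerA !mulNr !scaleNr -scaleNr.
  congr (_ *: _ - _ - _).
  by rewrite -mulrA bipairC sgn_mbideg mulrN opprK.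
rewrite (mult_relation_hlinear _ (c_linr y [::] [::])) scaler0 subr0.
apply/eqP; rewrite addr_eq0; apply/eqP.
rewrite [in RHS]big_nat_rev /= add0n -sumrN; apply: eq_big_nat => p /andP[_ hp].
have up : (u - (u - p) = p)%N by lia.
by rewrite subSS up mulNr scaleNr opprK.
Qed.

(** The outer map has a single input only if the inner one takes all of ys. *)
Let outer_corr p : \sum_(0 <= r < n) \sum_(0 <= q < n - r) s p r *:
    on_singleton (take r ys ++ brace_op p (take q.+1 (drop r ys))
                     :: drop (r + q.+1) ys)
      (fun y => sgn (bipair (mbideg (u - p)) (tag y)) *:
                  c (pbrace y [:: M (u - p)]))
  = S3 p - S4 p.
Proof.
have sizeL r q : (r < n)%N -> (q < n - r)%N ->
    size (take r ys ++ brace_op p (take q.+1 (drop r ys)) :: drop (r + q.+1) ys)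
    = (n - q)%N.
  by move=> hr hq; rewrite size_cat /= size_take size_drop hr; lia.
rewrite (big_ltn ys_gt0) [X in _ + X]big_nat_cond [X in _ + X]big1 => [|r];
  last first.
  rewrite andbT => /andP[r_gt0 hr]; rewrite big_nat_cond big1 // => q.
  rewrite andbT => /andP[_ hq].
  by rewrite on_singleton0 ?scaler0 // sizeL //; lia.
rewrite addr0 subn0; have [k hk] : exists k, n = k.+1 by exists n.-1; lia.
rewrite hk big_nat_recr //= big_nat_cond big1 ?add0r => [|q]; last first.
  rewrite andbT => /andP[_ hq].
  rewrite on_singleton0 ?scaler0 //.
  by have := sizeL 0%N q; rewrite take0 /= => ->; lia.
rewrite drop0 add0n -hk take_size drop_size /= /s take0 /mdeg big_nil bipair0.
rewrite sgn0 scale1r.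
rewrite -[on_singleton _ _]/(sgn (bipair (mbideg (u - p)) (mdeg ys + mbideg p))
  *: c (pbrace (brace_op p ys) [:: M (u - p)])) [mdeg ys + _]addrC.
rewrite (brace_op_hlinear _ _ (c_linl _)) scalerBr; congr (_ - _).
rewrite /S4; case: (ys) => [|y [|y' ys']] /=; rewrite ?scaler0 //.
by rewrite scalerA.
Qed.

Let inner_corr p : \sum_(0 <= r < n) \sum_(0 <= q < n - r) s p r *:
    on_singleton (take q.+1 (drop r ys)) (fun y =>
      sgn (bipair (mbideg p) (tag y)) *: c (pbrace (M (u - p))
        (take r ys ++ pbrace y [:: M p] :: drop (r + q.+1) ys)))
  = S2 p.
Proof.
apply: eq_big_nat => r /andP[_ hr].
rewrite big_ltn ?subn_gt0 // [X in _ + X]big_nat_cond [X in _ + X]big1 => [|q];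
  last first.
  rewrite andbT => /andP[q_gt0 hq]; rewrite on_singleton0 ?scaler0 //.
  by rewrite size_take size_drop; case: ifP; lia.
rewrite addr0 (drop_nth y0 hr) /= take0 /= scalerA addn1; congr (_ *: _).
by rewrite /s (take_nth y0 hr) -cats1 mdeg_cat mdeg1 sgn_bipairDr.
Qed.

(** The corrections of the outer and inner maps turn S1, the sum with plain
  braces, into S1 - S2 - S3 + S4; here S1 = - Q0, S3 = - (Q0 + S2) and S4 = 0
  after summation over p with the signs (-1)^p. *)
Lemma brace_op_square :
  \sum_(0 <= p < u.+1) (-1) ^+ p *:
    \sum_(0 <= r < n) \sum_(0 <= q < n - r)
      sgn (bipair (mbideg p) (mdeg (take r ys))) *:
      (hcomp e (brace_op (u - p) (take r ys ++
         brace_op p (take q.+1 (drop r ys)) :: drop (r + q.+1) ys)) N : Q N e)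
  = 0.
Proof.
transitivity (\sum_(0 <= p < u.+1) (-1) ^+ p *: (S1 p - S2 p - (S3 p - S4 p))).
  apply: eq_bigr => p _; congr (_ *: _).
  rewrite -inner_corr -outer_corr -!sumrB; apply: eq_bigr => r _.
  rewrite -!sumrB; apply: eq_bigr => q _.
  rewrite -!scalerBr; congr (_ *: _).
  rewrite -/(c _) (brace_op_hlinear _ _ c_linear); congr (_ - _).
  by rewrite (brace_op_hlinear _ _ (c_linr _ _ _)).
transitivity (\sum_(0 <= p < u.+1) (-1) ^+ p *: (S1 p + Q0 p)
  - \sum_(0 <= p < u.+1) (-1) ^+ p *: (Q0 p + S2 p)
  - \sum_(0 <= p < u.+1) (-1) ^+ p *: S3 p
  + \sum_(0 <= p < u.+1) (-1) ^+ p *: S4 p).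
  rewrite -!sumrB -big_split; apply: eq_bigr => p _ /=.
  rewrite -!scalerBr -scalerDr; congr (_ *: _).
  by rewrite opprB addrA addrAC opprD !addrA addrK addrAC.
by rewrite S1_Q0 S3E S4E sub0r opprK addNr addr0.
Qed.

End Square.
End Core.

(** * Shifting *)

Section ShiftFacts.
Variables (R : comPzRingType) (B : bimod R).

Lemma hcomp_shift (h : hbim (shift B)) e :
  hcomp e h = hcomp (e - (0, 1)) (shift_out h) :> B (e - (0, 1)).
Proof.
have [<-|ne] := eqVneq (tag h) e; first by rewrite hcomp_tag /shift_out hcomp_el.
by rewrite !hcomp_neq //; apply: contraNneq ne => /addIr ->.
Qed.

Lemma mdeg_shift (xs : seq (hbim (shift B))) :
  mdeg xs = mdeg [seq shift_out x | x <- xs] + (0, (size xs)%:Z).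
Proof.
elim: xs => [|x xs IH] /=; first by rewrite !mdeg0 addr0.
have -> : (0, (size xs).+1%:Z) = (0, 1) + (0, (size xs)%:Z) :> bideg.
  by rewrite -addn1 PoszD addrC.
rewrite !mdeg_cons IH -[tag (shift_out x)]/(tag x - (0, 1)).
by rewrite [RHS]addrACA subrK.
Qed.

Definition brace_sign (ys : seq (hbim B)) : int :=
  \sum_(v < size ys) (size ys - v.+1)%N%:Z * [seq (tag y).2 | y <- ys]`_v.

Lemma brace_sign_cons y ys :
  brace_sign (y :: ys) = (size ys)%:Z * (tag y).2 + brace_sign ys.
Proof.
by rewrite /brace_sign big_ord_recl /= subSS subn0.
Qed.

Lemma brace_sign_cat ys zs : brace_sign (ys ++ zs) =
  brace_sign ys + (size zs)%:Z * (mdeg ys).2 + brace_sign zs.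
Proof.
elim: ys => [|y ys IH] /=.
  by rewrite /brace_sign big_ord0 mdeg0 mulr0 !add0r.
rewrite !brace_sign_cons IH size_cat PoszD mdeg_cons.
rewrite -[(_ + mdeg ys).2]/((tag y).2 + (mdeg ys).2); ring.
Qed.

Lemma brace_sign_el ys zs d (y z : B d) :
  brace_sign (ys ++ el B y :: zs) = brace_sign (ys ++ el B z :: zs).
Proof. by rewrite !brace_sign_cat !brace_sign_cons. Qed.

End ShiftFacts.

Section Maps.
Variables (R : comPzRingType) (O : operad R).
Variable m : forall i j : nat, O j (i%:Z, 2 - i%:Z - j%:Z).
Local Notation Q := (osusp O).
Local Notation B := (prodmod Q).
Local Notation PQ := (osusp_operad O).

Lemma shift_out_brace_maps i (xs : seq (hbim (shift B))) :
  let ys := [seq shift_out x | x <- xs] in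
  shift_out (brace_maps m i xs) = hsc (sgn (brace_sign ys)) (brace_op m i ys).
Proof.
move=> ys.
have tagE : tag (shift_out (brace_maps m i xs)) = mdeg ys + mbideg i.
  rewrite -[LHS]/(mdeg xs + (i%:Z, 2 - (i%:Z + (size xs)%:Z)) - (0, 1)).
  rewrite mdeg_shift -/ys -[LHS]addrA -[LHS]addrA; congr (_ + _).
  rewrite -[LHS]/(0 + (i%:Z - 0), (size xs)%:Z + (2 - (i%:Z + (size xs)%:Z) - 1)).
  by congr pair; lia.
apply: el_ext => // e; have [<-|ne] := eqVneq (mdeg ys + mbideg i) e; last first.
  by rewrite !hcomp_neq // tagE.
rewrite (hlinearZ (@hlinear_hcomp _ _ _ _)).
rewrite (brace_op_hlinear m _ _ (@hlinear_hcomp _ _ _ _)).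
rewrite -tagE hcomp_el /= -/ys /brace_sign.
case: (ys) => [|y [|y' ys']]; rewrite /on_singleton ?subr0 //.
by rewrite big_ord1 subnn mul0r sgn0 scale1r /bipair; case: (tag y).
Qed.

Lemma brace_op_linear i e (ys zs : seq (hbim B)) :
  hlinear (fun T : hbim B => hcomp e (brace_op m i (ys ++ T :: zs))).
Proof.
move=> d a y z; apply: functional_extensionality_dep => N.
have cl : hlinear (fun T : hbim B => hcomp e T N : Q N e).
  by move=> d' b x x'; rewrite (hlinear_hcomp e).
rewrite -[RHS]/(a *: (hcomp e (brace_op m i (ys ++ el B y :: zs)) N : Q N e)
  + hcomp e (brace_op m i (ys ++ el B z :: zs)) N).
rewrite !(brace_op_hlinear m _ _ cl) scalerBr addrACA -opprD.
congr (_ - _); first exact: (pbrace_linr PQ).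
case: ys zs => [|y1 [|y2 ys]] [|z1 zs] /=; rewrite ?scaler0 ?addr0 //.
by rewrite (pbrace_linl PQ) scalerDr !scalerA mulrC.
Qed.

(** With A, B, C the inputs before, in and after the inner map: the sign of the
  structure equation, the Koszul sign of the inner map passing the shifted
  inputs A and the two signs in front of the braces.  Together they equal the
  sign in front of the brace of all inputs, times (-1)^p and the Koszul sign
  for the unshifted bidegrees. *)
Lemma brace_maps_sign p (As Bs Cs : seq (hbim B)) (T : hbim B) :
  tag T = mdeg Bs + mbideg p ->
  (-1) ^+ (size As * size Bs + size Cs + p * (size As + size Cs).+1) *
  (sgn (bipair (p%:Z, 2 - (p%:Z + (size Bs)%:Z)) (mdeg As + (0, (size As)%:Z)))
   * (sgn (brace_sign (As ++ T :: Cs)) * sgn (brace_sign Bs))) =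
  sgn (brace_sign (As ++ Bs ++ Cs)) *
    ((-1) ^+ p * sgn (bipair (mbideg p) (mdeg As))) :> R.
Proof.
move=> hT; rewrite -[(-1 : R) ^+ p]/(sgn p%:Z) -[(-1 : R) ^+ _]/(sgn (_%:Z)).
rewrite -!sgnD.
apply: eq_sgn; rewrite !brace_sign_cat brace_sign_cons hT size_cat.
rewrite [size (T :: Cs)]/=.
rewrite -[(mdeg Bs + mbideg p).2]/((mdeg Bs).2 + (1 - p%:Z)).
rewrite /bipair -[(mdeg As + _).1]/((mdeg As).1 + 0).
rewrite -[(mdeg As + _).2]/((mdeg As).2 + (size As)%:Z) addr0 /mbideg /=.
by rewrite !(PoszD, PoszM, intS); parity.
Qed.

End Maps.

Theorem theorem9p3 (R : comPzRingType) (O : operad R)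
    (O_bounded : hbounded_right O)
    (m : forall i j : nat, O j (i%:Z, 2 - i%:Z - j%:Z))
    (m_mult : derived_Ainf_multiplication m) :
  derived_Ainf_algebra (A := shift (prodmod (osusp O))) (brace_maps m).
Proof.
split=> // [i xs zs d e a y z|u xs xs_gt0 e].
  rewrite !hcomp_shift !shift_out_brace_maps.
  rewrite !(hlinearZ (@hlinear_hcomp _ _ _ _)) !map_cat /=.
  rewrite -![shift_out (el _ _)]/(el (prodmod (osusp O)) (i := d - (0, 1)) _).
  set As := map _ xs; set Cs := map _ zs.
  have signE (w : prodmod (osusp O) (d - (0, 1))) :
      brace_sign (As ++ el _ w :: Cs) =
      brace_sign (As ++ el (prodmod (osusp O)) (0 : prodmod _ (d - (0, 1)))
                    :: Cs).
    exact: brace_sign_el.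
  rewrite signE (signE y) (signE z).
  by rewrite (brace_op_linear m i _ _ _) scalerDr !scalerA mulrC.
set ys := [seq shift_out x | x <- xs].
have szE : size xs = size ys by rewrite size_map.
rewrite (Ainf_sumE u (size xs) (fun i j p q r =>
  sgn (bipair (p%:Z, 2 - (p%:Z + q%:Z)) (mdeg (take r xs))) *:
  hcomp e (brace_maps m i (take r xs ++ brace_maps m p (take q (drop r xs))
                          :: drop (r + q) xs)))).
have term p r q : (r < size xs)%N -> (q < size xs - r)%N ->
  (-1) ^+ (r * q.+1 + (size xs - q - r).-1 + p * (size xs - q)) *:
  (sgn (bipair (p%:Z, 2 - (p%:Z + q.+1%:Z)) (mdeg (take r xs))) *:
   hcomp e (brace_maps m (u - p) (take r xs ++
      brace_maps m p (take q.+1 (drop r xs)) :: drop (r + q.+1) xs))) =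
  sgn (brace_sign ys) *: ((-1) ^+ p *:
   (sgn (bipair (mbideg p) (mdeg (take r ys))) *:
    hcomp (e - (0, 1)) (brace_op m (u - p) (take r ys ++
      brace_op m p (take q.+1 (drop r ys)) :: drop (r + q.+1) ys)))).
  move=> hr hq.
  rewrite hcomp_shift shift_out_brace_maps map_cat /= shift_out_brace_maps.
  rewrite (hlinearZ (@hlinear_hcomp _ _ _ _)).
  rewrite (hlinearZ (brace_op_linear m _ _ _ _)).
  rewrite !map_take !map_drop -/ys.
  set T := hsc _ (brace_op m p _).
  rewrite !scalerA; congr (_ *: _).
  have hA : size (take r ys) = r by rewrite size_take -szE hr.
  have hB : size (take q.+1 (drop r ys)) = q.+1.
    by rewrite size_take size_drop -szE; case: ifP; lia.
  have hC : size (drop (r + q.+1) ys) = (size xs - q - r).-1.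
    by rewrite size_drop -szE; lia.
  have := @brace_maps_sign R O p (take r ys) (take q.+1 (drop r ys))
    (drop (r + q.+1) ys) T erefl.
  rewrite hA hB hC.
  have -> : (r + (size xs - q - r).-1).+1 = (size xs - q)%N by lia.
  rewrite mdeg_shift map_take -/ys size_take hr -!mulrA => ->.
  by rewrite [(r + _)%N]addnC -drop_drop !cat_take_drop.
apply: functional_extensionality_dep => N.
rewrite -[RHS](scaler0 _ (sgn (brace_sign ys))).
rewrite -(brace_op_square m_mult u (e - (0, 1)) N (ys := ys));
  last by rewrite -szE.
rewrite scaler_sumr dprod_sumE; apply: eq_bigr => p _.
rewrite dprod_sumE !scaler_sumr -szE; apply: eq_big_nat => r /andP[_ hr].
rewrite dprod_sumE !scaler_sumr; apply: eq_big_nat => q /andP[_ hq].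
by rewrite term.
Qed.
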